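(* Let $S$ be a closed topological surface with a cellular decomposition $\Sigma=(V,E,F)$, let $\Phi\in(0,\frac{\pi}{2})^{|E|}$ be a weight, let $1\le m\le |F|-1$ and $1\le i_1<\cdots<i_m\le |F|$, and let $\hat L=(\hat L_1,\dots,\hat L_{|F|})^T\in\mathcal{L}_{i_1\cdots i_m}$ be a prescribed total geodesic curvature on the face set $F$. For any initial geodesic curvature equal to $\tilde k(0)\in\mathbb{R}^m_{>0}$ on the face set $F_{i_1\cdots i_m}=\{i_1,\dots,i_m\}$ and to $0$ on $F\setminus F_{i_1\cdots i_m}$, the solution of the prescribed combinatorial Ricci flow $$\frac{d\tilde k_i}{dt}=-(L_i(\tilde k)-\hat L_i)\tilde k_i,\qquad i\in F_{i_1\cdots i_m},$$ (extended by $0$ on $F\setminus F_{i_1\cdots i_m}$) converges as $t\to+\infty$ to the unique, up to isometry, degenerated circle pattern metric with total geodesic curvature $\tilde L=(\hat L_{i_1},\dots,\hat L_{i_m})^T$ on $F_{i_1\cdots i_m}$ and $0$ on $F\setminus F_{i_1\cdots i_m}$. Moreover, if the solution converges to the degenerated circle pattern metric $\hat k$, then $\hat k\in\mathbb{R}^{|F|}_{i_1\cdots i_m}$.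
   Context: Cellular decomposition: $V,E,F$ are the finite sets of 0-, 1- and 2-cells of $\Sigma$, and $F=\{1,\dots,|F|\}$. For $f\in F$, $E_f$ is the set of 1-cells contained in $\partial f$ (every face has at least one such 1-cell). For $F'\subset F$, $E_{F'}=\{e\in E : \exists f\in F',\ e\in E_f\}$. The 2-cells on the two sides of $e\in E$ are denoted $f_1(e),f_2(e)$ (possibly equal). Bigons: for $r_1,r_2\in(0,\frac{\pi}{2}]$ and $\phi\in(0,\frac{\pi}{2})$, there are round disks $D_1,D_2\subset\mathbb{S}^2$ (unit sphere) of radii $r_1,r_2$, unique up to isometry, such that $D_1\cap D_2$ is a bigon with interior angle $\phi$; the distance $r_3$ between the centers satisfies $\cos r_3=\cos r_1\cos r_2-\sin r_1\sin r_2\cos\phi$. The two sides of the bigon are arcs of $\partial D_1$ and $\partial D_2$, of lengths $\ell_1,\ell_2$. The geodesic curvature of $\partial D_i$ is $k_i=\cot r_i\ge 0$, and the total geodesic curvature of the side on $\partial D_i$ is $\ell_ik_i$. Metrics: given radii $\mathbf r=(r_1,\dots,r_{|F|})\in(0,\frac{\pi}{2}]^{|F|}$, choose an auxiliary point in each 2-cell and join it to the vertices on the boundary of that 2-cell; for $e\in E$ let $Q(e)$ be the quadrilateral whose vertices are the end points of $e$ and the auxiliary points of the two 2-cells adjacent to $e$. Give $Q(e)$ the spherical metric of the quadrilateral whose vertices are the centers of two disks in $\mathbb{S}^2$ of radii $r_{f_1(e)},r_{f_2(e)}$ with intersection angle $\Phi(e)$ (interior angle of the bigon $B_e$ formed by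 their intersection) and the two intersection points of their boundary circles. Gluing the $Q(e)$ along their sides gives a spherical conical metric on $S$ together with a circle pattern realizing $\Phi$. Put $k_f=\cot r_f$; the metric with its circle pattern is identified with the vector $k=(k_1,\dots,k_{|F|})^T\in\mathbb{R}_{\ge0}^{|F|}$, which determines it up to isometry, so that ''unique up to isometry'' means that $k$ is unique, and convergence of metrics means convergence of the vectors $k$ in $\mathbb{R}^{|F|}$. It is called a degenerated circle pattern metric if some $k_f=0$ (some $r_f=\frac{\pi}{2}$). Total geodesic curvature: for $e\in E_f$, $L_{f,e}=\ell_{f,e}k_f$, where $\ell_{f,e}$ is the length of the side of $B_e$ lying on the boundary of the disk of $f$. The total geodesic curvature of $f$ is $L_f=L_f(k)=\sum_{e\in E_f}L_{f,e}$ (if $f$ lies on both sides of $e$, both sides of $B_e$ are counted). Sets: $\mathcal{L}_{i_1\cdots i_m}$ is the set of all $(L_1,\dots,L_{|F|})^T\in\mathbb{R}^{|F|}$ with $L_{i_j}>0$ for $1\le j\le m$, $L_i=0$ for $i\notin F_{i_1\cdots i_m}$, and $\sum_{f\in F'}L_f<2\sum_{e\in E_{F'}}\Phi(e)$ for every nonempty $F'\subset F_{i_1\cdots i_m}$. $\mathbb{R}^{|F|}_{i_1\cdots i_m}$ is the set of $k\in\mathbb{R}^{|F|}$ with $k_{i}>0$ for $i\in F_{i_1\cdots i_m}$ and $k_i=0$ otherwise. For $\tilde k=(\tilde k_i)_{i\in F_{i_1\cdots i_m}}\in\mathbb{R}^m_{>0}$, $L_i(\tilde k)$ denotes $L_i(k)$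 for the vector $k\in\mathbb{R}^{|F|}_{i_1\cdots i_m}$ with $k_i=\tilde k_i$ for $i\in F_{i_1\cdots i_m}$. *)

(* Defs.v *)
From HB Require Import structures.
From mathcomp Require Import all_boot all_order all_algebra.
From mathcomp Require Import all_classical all_reals all_analysis.

Set Implicit Arguments.
Unset Strict Implicit.
Unset Printing Implicit Defensive.

Import Order.TTheory GRing.Theory Num.Theory.
Import numFieldNormedType.Exports.

Local Open Scope classical_set_scope.
Local Open Scope ring_scope.

(** * Closed surfaces and cellular decompositions *)

Definition open_embedding_on (T U : topologicalType) (A : set T) (h : T -> U) :=
  [/\ {within A, continuous h}, set_inj A h &
      forall B : set T, B `<=` A -> open B -> open (h @` B)].

(* Compact and without boundary; connectedness is not required. *)
Definition closed_surface (R : realType) (S : topologicalType) :=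
  [/\ hausdorff_space S, compact [set: S] &
      forall x : S, exists h : R * R -> S,
        open_embedding_on [set: R * R] h /\ range h x].

Definition closed_disc (R : realType) : set (R * R) :=
  [set p | p.1 ^+ 2 + p.2 ^+ 2 <= 1].
Definition open_disc (R : realType) : set (R * R) :=
  [set p | p.1 ^+ 2 + p.2 ^+ 2 < 1].
Definition unit_circle (R : realType) : set (R * R) :=
  [set p | p.1 ^+ 2 + p.2 ^+ 2 = 1].

Arguments closed_disc : clear implicits.
Arguments open_disc : clear implicits.
Arguments unit_circle : clear implicits.

(* A finite CW structure of dimension 2 given by characteristic maps.  The
   faces are numbered by 'I_nfaces, that is, from 0 instead of 1.  The two faces
   on the sides of an edge are read off a product neighbourhood of the open
   edge; which of them is called [side1] is a choice. *)
Record cell_decomposition (R : realType) (S : topologicalType) := CellDecomposition {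
  vertex : finType;
  edge : finType;
  nfaces : nat;
  vertex_map : vertex -> S;
  edge_map : edge -> R -> S;
  face_map : 'I_nfaces -> R * R -> S;
  vcell := fun v => [set vertex_map v];
  ecell := fun e => edge_map e @` `]-1, 1[;
  fcell := fun f => face_map f @` open_disc R;
  skel0 := \bigcup_(v in [set: vertex]) vcell v;
  skel1 := skel0 `|` \bigcup_(e in [set: edge]) ecell e;
  edge_map_continuous : forall e, {within `[-1, 1], continuous (edge_map e)};
  face_map_continuous : forall f, {within closed_disc R, continuous (face_map f)};
  edge_map_inj : forall e, set_inj `]-1, 1[ (edge_map e);
  face_map_inj : forall f, set_inj (open_disc R) (face_map f);
  cell_partition : forall x : S, exists! c : vertex + edge + 'I_nfaces,
    match c with
    | inl (inl v) => vcell v x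
    | inl (inr e) => ecell e x
    | inr f => fcell f x
    end;
  edge_attach : forall e, skel0 (edge_map e (-1)) /\ skel0 (edge_map e 1);
  face_attach : forall f, face_map f @` unit_circle R `<=` skel1;
  face_boundary := fun f => closure (fcell f) `\` fcell f;
  face_has_edge : forall f, exists e, ecell e `<=` face_boundary f;
  side1 : edge -> 'I_nfaces;
  side2 : edge -> 'I_nfaces;
  sidesP : forall e, exists h : R * R -> S,
    [/\ open_embedding_on [set p : R * R | -1 < p.1 < 1 /\ -1 < p.2 < 1] h,
        forall t : R, -1 < t < 1 -> h (t, 0) = edge_map e t,
        forall t s : R, -1 < t < 1 -> 0 < s < 1 -> fcell (side1 e) (h (t, s)) &
        forall t s : R, -1 < t < 1 -> -1 < s < 0 -> fcell (side2 e) (h (t, s))]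
}.

Section Incidence.
Context {R : realType} {S : topologicalType} (D : cell_decomposition R S).

Definition edges_of (f : 'I_(nfaces D)) : {set edge D} :=
  [set e | `[< ecell e `<=` face_boundary f >]]%SET.

Definition edges_of_set (F' : {set 'I_(nfaces D)}) : {set edge D} :=
  [set e | [exists f in F', e \in edges_of f]]%SET.

Lemma cell_uniq (x : S) (c c' : vertex D + edge D + 'I_(nfaces D)) :
  let cell c := match c with
    | inl (inl v) => vcell v x
    | inl (inr e) => ecell e x
    | inr f => fcell f x
    end in cell c -> cell c' -> c = c'.
Proof.
move=> /= cx c'x; have [d [_ dP]] := cell_partition D x.
by rewrite -(dP c)// -(dP c').
Qed.

Lemma ecell_fcell (x : S) (e : edge D) (f : 'I_(nfaces D)) :
  ecell e x -> fcell f x -> False.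
Proof. by move=> ex fx; have := @cell_uniq x (inl (inr e)) (inr f) ex fx. Qed.

Lemma fcell_uniq (x : S) (f f' : 'I_(nfaces D)) :
  fcell f x -> fcell f' x -> f = f'.
Proof. by move=> fx f'x; have [] := @cell_uniq x (inr f) (inr f') fx f'x. Qed.

Lemma mem_edges_of (f : 'I_(nfaces D)) (e : edge D) :
  (e \in edges_of f) = (side1 e == f) || (side2 e == f).
Proof.
have [h [[hc hi ho] h0 h1 h2]] := sidesP e.
set U := [set p : R * R | _] in hc hi ho.
have oU : open U.
  have -> : U = (fst @^-1` `](-1 : R), 1[) `&` (snd @^-1` `](-1 : R), 1[).
    by apply/seteqP; split => -[a b]; rewrite /U /= !in_itv.
  apply: openI; (apply: open_comp; last exact: interval_open) => ? _.
    exact: cvg_fst.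
  exact: cvg_snd.
rewrite inE; apply/asboolP/orP => [eb|].
- have e0 : ecell e (h (0, 0)).
    by exists 0; rewrite ?h0 /= ?in_itv /= ?ltrN10 ?ltr01.
  have [cl _] := eb _ e0.
  have /cl : nbhs (h (0, 0)) (h @` U).
    apply: open_nbhs_nbhs; split; first exact: (ho U).
    by exists (0, 0) => //; rewrite /U /= ltrN10 ltr01.
  move=> [q [fq [[t s] [/= tU sU] hq]]].
  rewrite -hq in fq; have [s0|s0|s0] := ltrgtP s 0.
  + right; apply/eqP/esym; apply: (fcell_uniq fq); apply: h2 => //.
    by rewrite s0 andbT; case/andP: sU.
  + left; apply/eqP/esym; apply: (fcell_uniq fq); apply: h1 => //.
    by rewrite s0; case/andP: sU.
  + exfalso; apply: ecell_fcell fq; rewrite s0 h0 //.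
    by exists t => //; rewrite /= in_itv.
- move=> sf x [t /= tI <-]; rewrite in_itv/= in tI.
  split; last by apply: (@ecell_fcell _ e); exists t => //=; rewrite in_itv.
  move=> B; rewrite -h0// => nB.
  have tU : U (t, 0) by rewrite /U /= tI ltrN10 ltr01.
  have hct : {for (t, 0), continuous h}.
    by move: hc; rewrite continuous_open_subspace// => /(_ _ (mem_set tU)).
  have : nbhs (t, 0) (h @^-1` B `&` U).
    by apply: filterI; [exact: hct|exact: open_nbhs_nbhs].
  move=> [[P Q] /= [nP nQ] PQ].
  move: nQ => /nbhs_ballP[d /= d0 dQ].
  have Pt : P t by exact: nbhs_singleton.
  have sg (s : R) : `|s| < d -> B (h (t, s)) /\ U (t, s).
    move=> sd; apply: (PQ (t, s)); split => //=; apply: dQ.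
    by rewrite /ball /= sub0r normrN.
  have d2 : 0 < d / 2 by rewrite divr_gt0.
  have dd : d / 2 < d by rewrite ltr_pdivrMr// ltr_pMr// ltr1n.
  case: sf => /eqP <-.
  + have [|Bs [_ sU]] := sg (d / 2); first by rewrite gtr0_norm.
    exists (h (t, d / 2)); split => //; apply: h1 => //.
    by rewrite d2; case/andP: sU.
  + have [|Bs [_ sU]] := sg (- (d / 2)); first by rewrite normrN gtr0_norm.
    exists (h (t, - (d / 2))); split => //; apply: h2 => //.
    by rewrite oppr_lt0 d2 andbT; case/andP: sU.
Qed.

End Incidence.

(** * Bigons in the unit sphere *)

Section Bigons.
Context {R : realType}.

Definition dot3 (x y : R * R * R) : R :=
  x.1.1 * y.1.1 + x.1.2 * y.1.2 + x.2 * y.2.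

(* The point at distance [r] from the north pole, at longitude [t]. *)
Definition sphere_point (r t : R) : R * R * R :=
  (sin r * cos t, sin r * sin t, cos r).

Definition round_disk (c : R * R * R) (r : R) : set (R * R * R) :=
  [set x | dot3 x x = 1 /\ acos (dot3 x c) <= r].

Definition center_dist (r1 r2 phi : R) : R :=
  acos (cos r1 * cos r2 - sin r1 * sin r2 * cos phi).

(* Length of the side on the boundary of D_1 of the bigon cut out by D_1 and
   D_2.  D_1 is centred at the north pole, so that its boundary circle is
   [t |-> sphere_point r1 t], which has constant speed [sin r1]. *)
Definition bigon_side_length (r1 r2 phi : R) : R :=
  let D2 := round_disk (sphere_point (center_dist r1 r2 phi) 0) r2 in
  sin r1 * fine (@lebesgue_measure R
                   [set t | - pi < t <= pi /\ D2 (sphere_point r1 t)]).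

(* The inverse of cot : ]0, pi/2] -> [0, +oo[. *)
Definition radius (k : R) : R := pi / 2 - atan k.

Lemma radius_bounds (k : R) : 0 <= k -> 0 < radius k <= pi / 2.
Proof.
move=> k0; rewrite /radius subr_gt0 atan_ltpi2 /= gerBl -[leLHS](@atan0 R).
exact: le_atan.
Qed.

Lemma cot_radius (k : R) : cos (radius k) / sin (radius k) = k.
Proof.
rewrite /radius cosB sinB cos_pihalf sin_pihalf !mul0r !mul1r add0r subr0.
by rewrite -[RHS]atanK.
Qed.

(* Total geodesic curvature of the side on the boundary of D_1, in terms of the
   geodesic curvatures of the two boundary circles. *)
Definition side_curvature (k1 k2 phi : R) : R :=
  bigon_side_length (radius k1) (radius k2) phi * k1.

End Bigons.

(** * Circle pattern metrics *)

Section Metrics.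
Context {R : realType} {S : topologicalType} (D : cell_decomposition R S).
Variable Phi : edge D -> R.
Local Notation n := (nfaces D).

Definition total_curvature (k : 'cV[R]_n) (f : 'I_n) : R :=
  \sum_(e in edges_of f)
    ((if side1 e == f
      then side_curvature (k f 0) (k (side2 e) 0) (Phi e) else 0) +
     (if side2 e == f
      then side_curvature (k f 0) (k (side1 e) 0) (Phi e) else 0)).

(* A circle pattern metric is represented by its vector of geodesic curvatures. *)
Definition degenerated_metric (k : 'cV[R]_n) : Prop :=
  (forall f, 0 <= k f 0) /\ exists f, k f 0 = 0.

Section Subfaces.
Variables (m : nat) (i : 'I_m -> 'I_n).

Definition faces_in : {set 'I_n} := [set i j | j : 'I_m]%SET.

Definition curvature_set : set 'cV[R]_n :=
  [set L | [/\ forall j, 0 < L (i j) 0,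
               forall f, f \notin faces_in -> L f 0 = 0 &
               forall F' : {set 'I_n}, F' != finset.set0 -> F' \subset faces_in ->
                 \sum_(f in F') L f 0 < 2 * \sum_(e in edges_of_set F') Phi e]].

Definition coordinate_face : set 'cV[R]_n :=
  [set k | (forall f, f \in faces_in -> 0 < k f 0) /\
           (forall f, f \notin faces_in -> k f 0 = 0)].

Definition extend0 (kt : 'cV[R]_m) : 'cV[R]_n :=
  \col_f (if [pick j | i j == f] is Some j then kt j 0 else 0).

(* Solutions on [0, T[, of class C^0 on [0, T[ and satisfying the equation on
   ]0, T[. *)
Definition flow_solution (Lhat : 'cV[R]_n) (k0 : 'cV[R]_m) (T : \bar R)
    (K : R -> 'cV[R]_m) : Prop :=
  [/\ K 0 = k0,
      K t @[t --> 0^'+] --> k0,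
      forall t : R, 0 <= t -> (t%:E < T)%E -> forall j, 0 < K t j 0 &
      forall t : R, 0 < t -> (t%:E < T)%E -> forall j,
        is_derive t (1 : R) (fun s : R => K s j 0)
          (- (total_curvature (extend0 (K t)) (i j) - Lhat (i j) 0) * K t j 0)].

(* [K] is the maximal solution and it is defined on [0, +oo[. *)
Definition global_flow_solution (Lhat : 'cV[R]_n) (k0 : 'cV[R]_m)
    (K : R -> 'cV[R]_m) : Prop :=
  flow_solution Lhat k0 +oo%E K /\
  forall (T : \bar R) (K' : R -> 'cV[R]_m), (0 < T)%E ->
    flow_solution Lhat k0 T K' ->
    forall t : R, 0 <= t -> (t%:E < T)%E -> K' t = K t.

Definition realizes_curvature (Lhat k : 'cV[R]_n) : Prop :=
  [/\ degenerated_metric k,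
      forall j, total_curvature k (i j) = Lhat (i j) 0 &
      forall f, f \notin faces_in -> total_curvature k f = 0].

End Subfaces.
End Metrics.

(* Main.v *)
Require Import Defs.
From mathcomp Require Import all_boot all_order all_algebra.
From mathcomp Require Import all_classical all_reals all_analysis.
From mathcomp Require Import ring lra.
Import Order.TTheory GRing.Theory Num.Theory.
Import numFieldNormedType.Exports.
Local Open Scope classical_set_scope.
Local Open Scope ring_scope.

(** Spherical trigonometry turns the total geodesic curvature of one side of a bigon
    into [2 * sin a * acot (cos a * (k2 + k1 * cos phi) / sin phi)] with
    [a = atan k1] ([side_curvatureE]).  Four properties of this function of the
    curvatures [k1] and [k2] of the two circles are enough.
    - It is nonincreasing in [k2].
    - It strictly increases when [k1] and [k2] are multiplied by a common factor
      larger than 1, because [x * acot x] is increasing.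
    - It is globally Lipschitz in the logarithms of [k1] and [k2].
    - The two sides of one bigon add up to nearly [2 * phi] when both curvatures are
      large, and so does the side of the large curvature alone when the other one
      stays bounded: in the limit the two centers and a corner of the bigon span a
      euclidean triangle.

    In the coordinates [x = ln k] on the faces with positive curvature the flow is
    [x' = - (G x - b)], where [G] is the total curvature.  By the properties above
    [G i] is nonincreasing in every [x j] with [j != i] and strictly increasing under
    [x |-> x + d], and it is Lipschitz.  The first two properties give a maximum
    principle.
    - Uniqueness of the equilibrium ([comparison]): compare two solutions of
      [G x = b] at an index where their difference is maximal.
    - Existence ([perron_solution]): the subsolutions [G x <= b] are closed under
      maxima.  If they were unbounded exactly on the faces of [F'], the sums of the
      total curvatures over [F'] would approach twice the sum of the angles of the
      edges of [F'], against the strict inequality assumed for [F'].  The supremum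
      of the subsolutions therefore exists, and it is an equilibrium [xh].
    - The flow exists for all times by Picard iteration ([global_solution]) and is
      unique by a Gronwall estimate ([solution_unique]).
    - Convergence ([flow_converges]): [xh + (e + c * expR (- k * t))] is a strict
      supersolution for [e > 0], [c > 0] and [k] small enough, so that a solution
      starting below it stays below it; the lower bound is symmetric.

    A face of zero geodesic curvature has zero total curvature, and a face of positive
    geodesic curvature has positive total curvature.  Hence a metric realizing the
    prescribed curvatures is positive exactly on the prescribed faces and is
    determined there by the equilibrium. *)

Set Implicit Arguments.
Unset Strict Implicit.
Unset Printing Implicit Defensive.

(** * The side of a bigon *)

(** [radius] is the inverse cotangent; it occurs below with arguments that are
    not geodesic curvatures. *)
Local Notation acot := Defs.radius.

Section Bigon.
Context {R : realType}.
Implicit Types (a b r t x y k phi theta : R).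

Lemma acos_le x r : -1 <= x <= 1 -> 0 <= r <= pi -> (acos x <= r) = (cos r <= x).
Proof.
move=> x1 r0; have [a0 acx] := acos_def x1.
by rewrite -[in RHS]acx leNgt [RHS]leNgt ltr_cos.
Qed.

(** The expression is affine in [x] and equals [cos (a - b)] at [1] and [cos (a + b)]
    at [-1]. *)
Lemma sphere_dot_bounds a b x : -1 <= x <= 1 ->
  -1 <= cos a * cos b + sin a * sin b * x <= 1.
Proof.
move=> x1; have := cosB a b; have := cosD a b.
have := cos_geN1 (a + b); have := cos_le1 (a + b).
have := cos_geN1 (a - b); have := cos_le1 (a - b).
nra.
Qed.

Lemma measure_cos_arc theta : 0 <= theta < pi ->
  fine (@lebesgue_measure R [set t | - pi < t <= pi /\ cos theta <= cos t])
  = 2 * theta.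
Proof.
move=> /andP[t0 tpi].
have -> : [set t | - pi < t <= pi /\ cos theta <= cos t] = `[- theta, theta]%classic.
  have key t : - pi < t <= pi -> (cos theta <= cos t) = (`|t| <= theta).
    move=> tb; have ti : `|t| \in `[0, pi].
      by rewrite in_itv/= normr_ge0/= ler_norml; case/andP: tb => /ltW -> ->.
    have thi : theta \in `[0, pi] by rewrite in_itv/= t0 ltW.
    by rewrite -(cos_norm t) leNgt [RHS]leNgt ltr_cos.
  apply/seteqP; split => t /=; rewrite in_itv/= -ler_norml.
    by move=> [tb]; rewrite key.
  move=> tt; have tb : - pi < t <= pi.
    by move: tt; rewrite ler_norml; lra.
  by rewrite key.
rewrite lebesgue_measure_itv/= lte_fin.
by case: ifPn => [_|]; rewrite /=; lra.
Qed.

Lemma acot_gt0 x : 0 < acot x.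
Proof. by rewrite /Defs.radius subr_gt0 atan_ltpi2. Qed.

Lemma acot_ltpi x : acot x < pi.
Proof. by rewrite /acot; have := atan_gtNpi2 x; lra. Qed.

Lemma sin_acot x : sin (acot x) = cos (atan x).
Proof. by rewrite /Defs.radius sinB sin_pihalf cos_pihalf; lra. Qed.

Lemma cos_acot x : cos (acot x) = sin (atan x).
Proof. by rewrite /Defs.radius cosB sin_pihalf cos_pihalf; lra. Qed.

Lemma cos_atan_gt0 x : 0 < cos (atan x).
Proof. by apply: cos_gt0_pihalf; rewrite atan_gtNpi2 atan_ltpi2. Qed.

Lemma sin_atanE x : sin (atan x) = x * cos (atan x).
Proof. by rewrite -{2}[x]atanK /tan divfK// gt_eqF// cos_atan_gt0. Qed.

(** By the spherical law of cosines the point lies in the disk if and only if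
    [N <= sin d * cos t], where [d] is the distance between the centers and [N] the
    numerator of the fraction.  With [P] its denominator, [N ^+ 2 + P ^+ 2] is
    [sin d ^+ 2], so that [N / sin d] is the cosine of [acot (N / P)]. *)
Lemma round_disk_sphere_point r1 r2 phi t :
  0 < r1 <= pi / 2 -> 0 < r2 <= pi / 2 -> 0 < phi < pi / 2 ->
  round_disk (sphere_point (center_dist r1 r2 phi) 0) r2 (sphere_point r1 t) <->
  cos (acot ((sin r1 * cos r2 + cos r1 * sin r2 * cos phi) /
               (sin r2 * sin phi))) <= cos t.
Proof.
move=> r1b r2b phib.
have pi0 := pi_gt0 R.
set C := cos r1 * cos r2 - sin r1 * sin r2 * cos phi.
set N := sin r1 * cos r2 + _; set P := sin r2 * sin phi.
have s1 : 0 < sin r1 by apply: sin_gt0_pi; lra.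
have s2 : 0 < sin r2 by apply: sin_gt0_pi; lra.
have sp : 0 < sin phi by apply: sin_gt0_pi; lra.
have P0 : 0 < P by rewrite mulr_gt0.
have C1 : -1 <= C <= 1.
  have := @sphere_dot_bounds r1 r2 (- cos phi).
  rewrite /C lerN2 lerNl cos_le1 cos_geN1 => /(_ isT); lra.
have [d0 cd] := acos_def C1.
rewrite -/(center_dist r1 r2 phi) in d0 cd.
set d := center_dist r1 r2 phi in d0 cd *.
have NP : sin d ^+ 2 = N ^+ 2 + P ^+ 2.
  have -> : N ^+ 2 + P ^+ 2 = (cos r1 ^+ 2 + sin r1 ^+ 2) * cos r2 ^+ 2
      + (cos r1 ^+ 2 + sin r1 ^+ 2) * (sin r2 * cos phi) ^+ 2
      + sin r2 ^+ 2 * sin phi ^+ 2 - C ^+ 2 by rewrite /N /P /C; ring.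
  rewrite sin2cos2 cd !cos2Dsin2 !mul1r exprMn; congr (_ - _).
  suff -> : 1 = cos r2 ^+ 2 + sin r2 ^+ 2 * (cos phi ^+ 2 + sin phi ^+ 2)
    by ring.
  by rewrite cos2Dsin2 mulr1 cos2Dsin2.
set y := N / P; set g := cos (atan y).
have g0 : 0 < g := cos_atan_gt0 y.
have NE : N = y * P by rewrite divfK// gt_eqF.
have sd0 : 0 <= sin d by apply: sin_ge0_pi.
have sdg : sin d * g = P.
  have : (sin d * g) ^+ 2 = P ^+ 2.
    rewrite exprMn NP NE.
    have := cos2Dsin2 (atan y); rewrite sin_atanE -/g => gy.
    by rewrite -[RHS]mulr1 -gy; ring.
  have dg0 : 0 <= sin d * g by rewrite mulr_ge0// ltW.
  by move/eqP; rewrite eqrXn2// ?(ltW P0)// => /eqP.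
have sd : 0 < sin d by rewrite -(pmulr_lgt0 _ g0) sdg.
rewrite cos_acot sin_atanE -/g.
have dotE : dot3 (sphere_point r1 t) (sphere_point d 0)
    = cos r1 * cos d + sin r1 * sin d * cos t.
  by rewrite /dot3 /sphere_point/= cos0 sin0; ring.
have unit : dot3 (sphere_point r1 t) (sphere_point r1 t) = 1.
  have <- := cos2Dsin2 r1; have := cos2Dsin2 t.
  rewrite /dot3 /sphere_point/= => e.
  by rewrite -[sin r1 ^+ 2]mulr1 -e; ring.
have dot1 : -1 <= dot3 (sphere_point r1 t) (sphere_point d 0) <= 1.
  by rewrite dotE; apply: sphere_dot_bounds; rewrite cos_geN1 cos_le1.
have -> : (y * g <= cos t) = (cos r2 <= dot3 (sphere_point r1 t) (sphere_point d 0)).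
  rewrite dotE -lerBlDl cd.
  have -> : cos r2 - cos r1 * C = sin r1 * N.
    rewrite /C /N.
    have -> : cos r1 * (cos r1 * cos r2 - sin r1 * sin r2 * cos phi) =
      cos r1 ^+ 2 * cos r2 - cos r1 * sin r1 * sin r2 * cos phi by ring.
    by rewrite cos2sin2; ring.
  by rewrite -mulrA (ler_pM2l s1) NE -sdg mulrCA ler_pM2l.
rewrite -acos_le//; last by lra.
by split=> [[]|].
Qed.

Lemma side_curvatureE k1 k2 phi : 0 <= k1 -> 0 <= k2 -> 0 < phi < pi / 2 ->
  side_curvature k1 k2 phi =
  2 * sin (atan k1) * acot (cos (atan k1) * (k2 + k1 * cos phi) / sin phi).
Proof.
move=> k10 k20 phib; rewrite /side_curvature /bigon_side_length.
set y := cos (atan k1) * _ / _.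
have sp : 0 < sin phi by apply: sin_gt0_pi; have := pi_gt0 R; lra.
have -> : [set t | - pi < t <= pi /\
    round_disk (sphere_point (center_dist (acot k1) (acot k2) phi) 0)
      (acot k2) (sphere_point (acot k1) t)]
  = [set t | - pi < t <= pi /\ cos (acot y) <= cos t].
  suff yE : y = (sin (acot k1) * cos (acot k2) +
      cos (acot k1) * sin (acot k2) * cos phi) / (sin (acot k2) * sin phi).
    apply/seteqP; split => t /= [tb]; rewrite round_disk_sphere_point -?yE//;
      exact: radius_bounds.
  rewrite !sin_acot !cos_acot !sin_atanE /y; field.
  by rewrite !gt_eqF ?cos_atan_gt0.
rewrite measure_cos_arc ?acot_ltpi ?ltW ?acot_gt0//.
by rewrite sin_acot sin_atanE; ring.
Qed.
End Bigon.

(** * Comparison of increments *)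

Section MeanValue.
Context {R : realType}.
Implicit Types (f df g dg : R -> R) (a b x y : R).

Lemma increment_le f df g dg a b : a <= b ->
  (forall x, x \in `]a, b[ -> is_derive x 1 f (df x)) ->
  (forall x, x \in `]a, b[ -> is_derive x 1 g (dg x)) ->
  {within `[a, b], continuous f} -> {within `[a, b], continuous g} ->
  (forall x, x \in `]a, b[ -> df x <= dg x) -> f b - f a <= g b - g a.
Proof.
move=> ab fd gd fc gc le; rewrite -subr_ge0.
move: ab; rewrite le_eqVlt => /predU1P[->|ab]; first by rewrite !subrr.
have hd x : x \in `]a, b[ -> is_derive x 1 (g - f) (dg x - df x).
  by move=> xab; apply: is_deriveB; [exact: gd|exact: fd].
have hc : {within `[a, b], continuous (g - f)}.
  by move=> x; apply: cvgB; [exact: gc|exact: fc].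
have [c cab e] := MVT ab hd hc.
have -> : g b - g a - (f b - f a) = (g - f) b - (g - f) a.
  by rewrite !fctE; ring.
by rewrite e mulr_ge0// subr_ge0 ?le// ltW.
Qed.

Lemma is_derive_continuous f x (d : R) : is_derive x 1 f d -> {for x, continuous f}.
Proof. by move=> [fx _]; apply/differentiable_continuous/derivable1_diffP. Qed.

Lemma increment_le_cc f df g dg a b : a <= b ->
  (forall x, a <= x <= b -> is_derive x 1 f (df x)) ->
  (forall x, a <= x <= b -> is_derive x 1 g (dg x)) ->
  (forall x, a <= x <= b -> df x <= dg x) -> f b - f a <= g b - g a.
Proof.
move=> ab fd gd le.
have wc (h dh : R -> R) : (forall x, a <= x <= b -> is_derive x 1 h (dh x)) ->
    {within `[a, b], continuous h}.
  move=> hd; apply: derivable_within_continuous => x; rewrite in_itv/= => xab.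
  by have [] := hd x xab.
have oc x : x \in `]a, b[ -> a <= x <= b.
  by rewrite in_itv/= => /andP[/ltW -> /ltW ->].
apply: (@increment_le _ df _ dg) => //; try exact: wc.
- by move=> x /oc; exact: fd.
- by move=> x /oc; exact: gd.
- by move=> x /oc; exact: le.
Qed.

End MeanValue.

(** * Monotonicity and growth of the side curvature *)

Section ArcCotangent.
Context {R : realType}.
Implicit Types (x y z d : R).

Lemma sin_le x : 0 <= x -> sin x <= x.
Proof.
move=> x0; have := @increment_le_cc R sin cos id (fun=> 1) 0 x x0.
by rewrite sin0 !subr0; apply=> *; exact: cos_le1.
Qed.

Lemma acot_le : {homo (@Defs.radius R) : x y /~ x <= y}.
Proof. by move=> x y xy; rewrite /Defs.radius lerB// le_atan. Qed.

Lemma sin_atan_lt1 x : sin (atan x) < 1.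
Proof.
rewrite lt_neqAle sin_le1 andbT; apply/eqP => e.
have := cos2Dsin2 (atan x); rewrite e expr1n => /eqP.
by rewrite -subr_eq0 addrK expf_eq0/= gt_eqF// cos_atan_gt0.
Qed.

Lemma sin_atan_ge0 x : 0 <= x -> 0 <= sin (atan x).
Proof. by move=> x0; rewrite sin_atanE mulr_ge0// ltW// cos_atan_gt0. Qed.

Lemma sin_atan_gt0 x : 0 < x -> 0 < sin (atan x).
Proof. by move=> x0; rewrite sin_atanE mulr_gt0// cos_atan_gt0. Qed.

Lemma atan_itv x : atan x \in `[- (pi / 2), pi / 2].
Proof. by rewrite in_itv/= !ltW ?atan_gtNpi2 ?atan_ltpi2. Qed.

Lemma le_sin_atan : {homo (fun x => sin (atan x) : R) : x y / x <= y}.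
Proof.
by move=> x y xy; rewrite leNgt ltr_sin ?atan_itv// -leNgt le_atan.
Qed.

Lemma atan_pihalf_ge0 x : 0 <= x -> 0 <= atan x.
Proof. by move=> x0; rewrite -[leLHS](@atan0 R) le_atan. Qed.

Lemma acot_le_pihalf x : 0 <= x -> acot x <= pi / 2.
Proof. by move=> x0; rewrite /Defs.radius gerBl atan_pihalf_ge0. Qed.

Lemma cos_atanK x : cos (atan x) ^+ 2 * (1 + x ^+ 2) = 1.
Proof. by rewrite -[RHS](cos2Dsin2 (atan x)) sin_atanE; ring. Qed.

(** With [x = cot t] the derivative is [t - sin t * cos t]. *)
Lemma lt_mul_acot x y : 0 < x -> x < y -> x * acot x < y * acot y.
Proof.
move=> x0 xy; rewrite -subr_gt0.
pose dh z := acot z - z * (1 + z ^+ 2)^-1.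
have hd z : is_derive z 1 (fun z : R => z * acot z) (dh z).
  rewrite /Defs.radius; apply: is_derive_eq.
  by rewrite /dh /Defs.radius !scaler1 /GRing.scale/=; ring.
have hc : {within `[x, y], continuous (fun z : R => z * acot z)}.
  by apply: derivable_within_continuous => z _; have [] := hd z.
have [c] := MVT xy (fun z _ => hd z) hc.
rewrite in_itv/= => /andP[xc _] ->; rewrite mulr_gt0 ?subr_gt0//.
have c0 : 0 < c := lt_trans x0 xc.
have [g0 s1] := (cos_atan_gt0 c, sin_atan_lt1 c).
have -> : c * (1 + c ^+ 2)^-1 = sin (acot c) * cos (acot c).
  rewrite sin_acot cos_acot sin_atanE -[(1 + _)^-1]mul1r -{1}(cos_atanK c).
  rewrite mulfK; first by ring.
  by rewrite gt_eqF// ltr_wpDr// sqr_ge0.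
apply: (@lt_le_trans _ _ (sin (acot c))); last by apply/sin_le/ltW/acot_gt0.
by rewrite gtr_pMr ?cos_acot ?sin_acot.
Qed.

(** The function [atan \o expR] is 1-Lipschitz. *)
Lemma atan_increment x y d : 0 < x -> 0 <= d -> y <= expR d * x ->
  atan y - atan x <= d.
Proof.
move=> x0 d0 yx; have [z zx] := expR_total x0.
apply: (@le_trans _ _ (atan (expR (z + d)) - atan (expR z))).
  by rewrite zx lerD2r le_atan// expRD zx mulrC.
pose da (t : R) := (1 + expR t ^+ 2)^-1 * expR t.
have hd (t : R) : is_derive t 1 (atan \o expR) (da t) by exact: is_derive1_comp.
have := @increment_le_cc R (atan \o expR) da id (fun=> 1) z (z + d).
rewrite /= [z + d - z]addrC addKr; apply=> //; first by rewrite lerDl.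
move=> t _; rewrite /da mulrC ler_pdivrMr ?mul1r.
  by have := sqr_ge0 (expR t - 1); have := expR_ge0 t; nra.
by rewrite ltr_wpDr// sqr_ge0.
Qed.

End ArcCotangent.

Section SideCurvature.
Context {R : realType} (phi : R) (phib : 0 < phi < pi / 2).
Implicit Types (k d e B M : R).
Local Notation side k1 k2 := (side_curvature k1 k2 phi).

Let sin_phi : 0 < sin phi.
Proof. by apply: sin_gt0_pi; move: phib (pi_gt0 R); lra. Qed.

Let cos_phi : 0 < cos phi.
Proof.
by apply: cos_gt0_pihalf; move: phib (pi_gt0 R); lra.
Qed.

Let arg_ge0 k1 k2 : 0 <= k1 -> 0 <= k2 ->
  0 <= cos (atan k1) * (k2 + k1 * cos phi) / sin phi.
Proof.
move=> k10 k20; rewrite divr_ge0 ?(ltW sin_phi)// mulr_ge0 ?(ltW (cos_atan_gt0 _))//.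
by rewrite addr_ge0// mulr_ge0// ltW.
Qed.

Lemma side_curvature_gt0 k1 k2 : 0 < k1 -> 0 <= k2 -> 0 < side k1 k2.
Proof.
move=> k10 k20; rewrite side_curvatureE ?(ltW k10)//.
by rewrite !mulr_gt0 ?sin_atan_gt0 ?acot_gt0.
Qed.

Lemma side_curvature_le k1 k2 : 0 <= k1 -> 0 <= k2 -> side k1 k2 <= pi * k1.
Proof.
move=> k10 k20; rewrite side_curvatureE//.
have h1 := acot_le_pihalf (arg_ge0 k10 k20).
have h2 : sin (atan k1) <= k1.
  by rewrite sin_atanE ler_piMr// cos_le1.
have h3 := sin_atan_ge0 k10; have := pi_gt0 R.
have := acot_gt0 (cos (atan k1) * (k2 + k1 * cos phi) / sin phi).
nra.
Qed.

Lemma side_curvature_nincr k1 k2 k2' : 0 <= k1 -> 0 <= k2 -> k2 <= k2' ->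
  side k1 k2' <= side k1 k2.
Proof.
move=> k10 k20 kk; rewrite !side_curvatureE ?(le_trans k20 kk)//.
rewrite ler_wpM2l// ?mulr_ge0 ?sin_atan_ge0// acot_le// ler_pM2r ?invr_gt0//.
by rewrite ler_pM2l ?cos_atan_gt0// lerD2r.
Qed.

(** Scaling both curvatures by [l] fixes [a = (k2 / k1 + cos phi) / sin phi], and
    the side is [2 / a] times the value of [x * acot x] at the increasing
    [x = a * sin (atan k1)]. *)
Lemma side_curvature_scale k1 k2 l : 0 < k1 -> 0 <= k2 -> 1 < l ->
  side k1 k2 < side (l * k1) (l * k2).
Proof.
move=> k10 k20 l1; have l0 : 0 < l := lt_trans ltr01 l1.
rewrite !side_curvatureE ?mulr_ge0 ?(ltW l0) ?(ltW k10)//.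
pose a := (k2 / k1 + cos phi) / sin phi.
have a0 : 0 < a.
  by apply: divr_gt0 => //; apply: ltr_wpDl => //; rewrite divr_ge0// ltW.
have argE m : 0 < m -> cos (atan (m * k1)) * (m * k2 + m * k1 * cos phi) / sin phi
    = sin (atan (m * k1)) * a.
  by move=> m0; rewrite sin_atanE /a; field; rewrite !gt_eqF//.
have := argE 1 ltr01; rewrite !mul1r (argE l)// => ->.
clearbody a.
have hE s : 2 * s * acot (s * a) = 2 / a * (s * a * acot (s * a)).
  by field; rewrite gt_eqF.
rewrite !hE ltr_pM2l ?divr_gt0//.
apply: lt_mul_acot; first by rewrite mulr_gt0 ?sin_atan_gt0.
rewrite ltr_pM2r// ltr_sin ?atan_itv// lt_atan//.
by rewrite ltr_pMl.
Qed.

(** All the factors of the explicit formula are Lipschitz in the logarithms of the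
    curvatures: [sin (atan k1)] with constant 1, the inverse cotangent with
    constant 2, because its argument is multiplied by at most [expR (2 * d)];
    and [4 + pi <= 8]. *)
Lemma side_curvature_lipschitz k1 k2 k1' k2' d : 0 < k1 -> 0 < k1' ->
  0 <= k2 -> 0 <= k2' -> 0 <= d ->
  k1 <= expR d * k1' -> k1' <= expR d * k1 -> k2' <= expR d * k2 ->
  side k1 k2 - side k1' k2' <= 8 * d.
Proof.
move=> k10 k10' k20 k20' d0 h1 h2 h3.
rewrite !side_curvatureE ?(ltW k10) ?(ltW k10')//.
set x := cos _ * _ / _; set x' := cos _ * _ / _.
have ed := expR_gt0 d.
have u1 : sin (atan k1) - sin (atan k1') <= d.
  have [le|lt] := leP k1 k1'.
    by apply: le_trans d0; rewrite subr_le0 le_sin_atan.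
  have := @increment_le_cc R sin cos id (fun=> 1) _ _ (le_atan (ltW lt)).
  move=> /(_ _ _ _)/le_trans; apply; last exact: atan_increment.
  by move=> *; exact: cos_le1.
have c1 : cos (atan k1') <= expR d * cos (atan k1).
  have [le|lt] := leP k1' k1.
    have := le_sin_atan le; rewrite !sin_atanE => s1.
    rewrite -(ler_pM2l k10'); apply: (le_trans s1).
    by rewrite mulrA ler_pM2r ?cos_atan_gt0// mulrC.
  apply: (@le_trans _ _ (cos (atan k1))).
    have ai k : 0 < k -> atan k \in `[0, pi].
      rewrite in_itv/= => k0; rewrite atan_pihalf_ge0 ?(ltW k0)//=.
      by have := atan_ltpi2 k; have := pi_gt0 R; lra.
    by rewrite leNgt ltr_cos ?ai// -leNgt le_atan// ltW.
  by rewrite ler_peMl ?(ltW (cos_atan_gt0 _))// -expR0 ler_expR.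
have x0 : 0 < x.
  rewrite divr_gt0// mulr_gt0 ?cos_atan_gt0// ltr_wpDl// mulr_gt0//.
have xx : x' <= expR (2 * d) * x.
  have n1 : k2' + k1' * cos phi <= expR d * (k2 + k1 * cos phi).
    by rewrite mulrDr lerD// mulrA ler_pM2r.
  have -> : expR (2 * d) * x = (expR d * cos (atan k1)) *
      (expR d * (k2 + k1 * cos phi)) / sin phi.
    by rewrite /x mulr_natl mulr2n expRD; ring.
  rewrite ler_pM2r ?invr_gt0//.
  apply: ler_pM => //; first by rewrite ltW ?cos_atan_gt0.
  by rewrite addr_ge0// mulr_ge0// ltW.
have th : acot x - acot x' <= 2 * d.
  have -> : acot x - acot x' = atan x' - atan x by rewrite /Defs.radius; lra.
  by apply: atan_increment => //; rewrite mulr_ge0.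
have t1 := acot_le_pihalf (ltW x0); have t0 := acot_gt0 x.
have s1 := sin_atan_lt1 k1'; have s0 := sin_atan_gt0 k10'.
have := pihalf_lt2 R.
have -> : 2 * sin (atan k1) * acot x - 2 * sin (atan k1') * acot x' =
  2 * ((sin (atan k1) - sin (atan k1')) * acot x) +
  2 * (sin (atan k1') * (acot x - acot x')) by ring.
move: (sin _ - sin _) u1 => u u1; move: (acot x - acot x') th => th' th pi2.
have : u * acot x <= d * 2 by apply: (@le_trans _ _ (d * acot x)); nra.
nra.
Qed.

Lemma acot_cos_sin : acot (cos phi / sin phi) = phi.
Proof.
have -> : cos phi / sin phi = tan (pi / 2 - phi).
  by rewrite /tan sinB cosB sin_pihalf cos_pihalf !mul0r !mul1r subr0 add0r.
rewrite /Defs.radius tanK ?in_itv/=; first by lra.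
by move: phib; lra.
Qed.

(** In a euclidean triangle with sides [1] and [q] and outer angle [phi] between them,
    these are the other two angles, and they add up to the outer one. *)
Lemma euclidean_angle_sum q : 0 < q ->
  acot ((q + cos phi) / sin phi) + acot ((q^-1 + cos phi) / sin phi) = phi.
Proof.
move=> q0; set y := (q + _) / _; set b := atan y.
have g0 : 0 < cos b := cos_atan_gt0 y.
have bphi : pi / 2 - phi < b.
  have := acot_cos_sin; rewrite /Defs.radius => <-.
  have : atan (cos phi / sin phi) < b by rewrite lt_atan// ltr_pM2r ?invr_gt0// ltrDr.
  by lra.
have bpi : b < pi / 2 := atan_ltpi2 y.
suff : atan ((q^-1 + cos phi) / sin phi) = pi - (phi + b).
  by rewrite /Defs.radius -/b => ->; lra.
rewrite -[RHS]tanK ?in_itv/=; last by move: phib (pi_gt0 R); lra.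
congr atan; rewrite /tan sinB cosB sinpi cospi !mul0r mulN1r addr0 sub0r mulN1r opprK.
have sE : sin b = y * cos b := sin_atanE y.
have -> : cos (phi + b) = - (q * cos b).
  by rewrite cosD sE /y; field; rewrite gt_eqF.
have -> : sin (phi + b) = (sin phi ^+ 2 + cos phi ^+ 2 + q * cos phi) / sin phi * cos b.
  by rewrite sinD sE /y; field; rewrite gt_eqF.
rewrite [sin phi ^+ 2 + _]addrC cos2Dsin2.
by field; rewrite !gt_eqF.
Qed.

(** A lower bound for the total curvature carried by an edge in terms of the inverse
    [e] of its large curvature, [B] being a bound for the bounded ones. *)
Definition side_lower B e := 2 * cos (atan e) * acot ((B * e + cos phi) / sin phi).

Lemma side_lower0 B : side_lower B 0 = 2 * phi.
Proof. by rewrite /side_lower atan0 cos0 mulr0 add0r acot_cos_sin mulr1. Qed.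

Lemma continuous_side_lower B : continuous (side_lower B).
Proof.
move=> e; rewrite /side_lower /Defs.radius.
apply: cvgM; first apply: cvgMr.
  apply: (@continuous_comp _ _ _ atan cos); first exact: continuous_atan.
  exact: continuous_cos.
apply: cvgB; first exact: cvg_cst.
apply: (@continuous_comp _ _ _ (fun x => (B * x + cos phi) / sin phi) atan).
  apply: cvgMl; apply: cvgD; last exact: cvg_cst.
  by apply: cvgMr; exact: cvg_id.
exact: continuous_atan.
Qed.

Lemma cos_atan_le_sin_atan e k : 0 < e -> 1 <= e * k -> cos (atan e) <= sin (atan k).
Proof.
move=> e0 ek; have k0 : 0 < k by rewrite -(pmulr_rgt0 _ e0) (lt_le_trans _ ek).
have [c0 g0] := (cos_atan_gt0 k, cos_atan_gt0 e).
rewrite -(@ler_pXn2r _ 2) ?nnegrE ?(ltW g0) ?sin_atan_ge0 ?(ltW k0)//.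
have := cos_atanK e; have := cos_atanK k; rewrite sin_atanE.
move: (cos (atan e)) (cos (atan k)) c0 g0 => g c c0 g0 hc hg.
have ek2 : 1 <= e ^+ 2 * k ^+ 2 by rewrite -exprMn exprn_ege1.
have g2 := sqr_ge0 g; have c2 := sqr_ge0 c.
rewrite exprMn; move: (g ^+ 2) (c ^+ 2) (e ^+ 2) (k ^+ 2) (sqr_ge0 e) (sqr_ge0 k) hc hg ek2 g2 c2.
move=> G C E K E0 K0 hc hg ek2 g2 c2; nra.
Qed.

Let side_angle_ge e k1 k2 : 0 < e -> 1 <= e * k1 -> 0 <= k2 ->
  [/\ 0 < k1, cos (atan e) <= sin (atan k1) &
      acot ((k2 / k1 + cos phi) / sin phi) <=
      acot (cos (atan k1) * (k2 + k1 * cos phi) / sin phi)].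
Proof.
move=> e0 ek k20; have k0 : 0 < k1 by rewrite -(pmulr_rgt0 _ e0) (lt_le_trans _ ek).
split=> //; first exact: cos_atan_le_sin_atan.
apply: acot_le; rewrite ler_pM2r ?invr_gt0//.
have -> : cos (atan k1) * (k2 + k1 * cos phi) = sin (atan k1) * (k2 / k1 + cos phi).
  by rewrite sin_atanE; field; rewrite gt_eqF.
by rewrite ler_piMl ?sin_le1// addr_ge0 ?(ltW cos_phi)// divr_ge0// ltW.
Qed.

Lemma side_curvature_ge e k1 k2 B : 0 < e -> 1 <= e * k1 -> 0 <= k2 <= B ->
  side_lower B e <= side k1 k2.
Proof.
move=> e0 ek /andP[k20 kB]; have [k0 cs ac] := side_angle_ge e0 ek k20.
rewrite side_curvatureE ?(ltW k0)// /side_lower.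
apply: ler_pM; rewrite ?mulr_ge0 ?(ltW (cos_atan_gt0 _)) ?(ltW (acot_gt0 _)) ?ler_pM2l//.
apply: le_trans ac; apply: acot_le; rewrite ler_pM2r ?invr_gt0// lerD2r.
rewrite ler_pdivrMr//; apply: (le_trans kB).
by rewrite -mulrA ler_peMr// (le_trans k20).
Qed.

Lemma side_curvatures_ge e k1 k2 B : 0 < e -> 1 <= e * k1 -> 1 <= e * k2 -> 0 <= B ->
  side_lower B e <= side k1 k2 + side k2 k1.
Proof.
move=> e0 ek1 ek2 B0.
have pos k : 1 <= e * k -> 0 <= k.
  by move=> ek; rewrite -(pmulr_rge0 _ e0) (le_trans _ ek).
have [k10 cs1 ac1] := side_angle_ge e0 ek1 (pos _ ek2).
have [k20 cs2 ac2] := side_angle_ge e0 ek2 (pos _ ek1).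
have := euclidean_angle_sum (divr_gt0 k20 k10); rewrite invf_div => sumE.
have ub : side_lower B e <= 2 * cos (atan e) * phi.
  rewrite /side_lower ler_pM2l ?mulr_gt0 ?cos_atan_gt0// -[leRHS]acot_cos_sin.
  by apply: acot_le; rewrite ler_pM2r ?invr_gt0// lerDr mulr_ge0// ltW.
apply: (le_trans ub); rewrite -[in leLHS]sumE mulrDr !side_curvatureE ?(ltW k10) ?(ltW k20)//.
by apply: lerD; apply: ler_pM;
  rewrite ?mulr_ge0 ?(ltW (cos_atan_gt0 _)) ?(ltW (acot_gt0 _)) ?ler_pM2l.
Qed.

End SideCurvature.

(** * Total curvatures of the faces *)

Section TotalCurvature.
Context {R : realType} {S : topologicalType} (D : cell_decomposition R S).
Variable Phi : edge D -> R.
Hypothesis hPhi : forall e, 0 < Phi e < pi / 2.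
Local Notation n := (nfaces D).
Implicit Types (k : 'cV[R]_n) (f g : 'I_n) (e : edge D).
Local Notation L := (total_curvature Phi).

Let term k f e : R :=
  (if side1 e == f then side_curvature (k f 0) (k (side2 e) 0) (Phi e) else 0) +
  (if side2 e == f then side_curvature (k f 0) (k (side1 e) 0) (Phi e) else 0).

Let totalE k f : L k f = \sum_(e in edges_of f) term k f e.
Proof. by []. Qed.

Let term_out k f e : e \notin edges_of f -> term k f e = 0.
Proof. by rewrite mem_edges_of negb_or /term => /andP[/negPf-> /negPf->]; rewrite addr0. Qed.

Let total_allE k f : L k f = \sum_e term k f e.
Proof.
rewrite totalE big_mkcond; apply: eq_bigr => e _.
by case: ifPn => // /term_out ->.
Qed.

Let exists_edge f : exists e, e \in edges_of f.
Proof.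
have [e ef] := face_has_edge f; exists e.
by rewrite inE; apply/asboolP.
Qed.

Lemma total_curvature_eq0 k f : k f 0 = 0 -> L k f = 0.
Proof.
move=> k0; rewrite total_allE big1// => e _.
by rewrite /term /side_curvature k0 !mulr0 !if_same addr0.
Qed.

Let lt_total k k' f : (forall e, e \in edges_of f -> term k f e < term k' f e) ->
  L k f < L k' f.
Proof.
move=> lt; rewrite !totalE; have [e ef] := exists_edge f.
rewrite (bigD1 e)//= [X in _ < X](bigD1 e)//=.
by apply: ltr_leD; [exact: lt|apply: ler_sum => e' /andP[ef' _]; exact/ltW/lt].
Qed.

Lemma total_curvature_gt0 k f : (forall g, 0 <= k g 0) -> 0 < k f 0 -> 0 < L k f.
Proof.
move=> k0 kf; have <- : L 0 f = 0 by apply: total_curvature_eq0; rewrite mxE.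
apply: lt_total => e.
have s0 g : 0 < side_curvature (k f 0) (k g 0) (Phi e).
  exact: side_curvature_gt0.
have -> : term 0 f e = 0.
  by rewrite /term /side_curvature !mxE !mulr0 !if_same addr0.
rewrite mem_edges_of /term => /orP[->|->].
  by rewrite ltr_wpDr//; case: ifP => // _; exact/ltW/s0.
by rewrite ltr_wpDl//; case: ifP => // _; exact/ltW/s0.
Qed.

Lemma total_curvature_scale k f (l : R) : (forall g, 0 <= k g 0) -> 0 < k f 0 ->
  1 < l -> L k f < L (l *: k) f.
Proof.
move=> k0 kf l1; apply: lt_total => e; rewrite /term !mxE.
have lt g : side_curvature (k f 0) (k g 0) (Phi e) <
    side_curvature (l * k f 0) (l * k g 0) (Phi e).
  exact: side_curvature_scale.
rewrite mem_edges_of; case: ifP => _; case: ifP => _ // _.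
- exact: ltrD.
- by rewrite !addr0.
- by rewrite !add0r.
Qed.

Lemma total_curvature_nincr k k' f : (forall g, 0 <= k g 0) ->
  (forall g, k g 0 <= k' g 0) -> k f 0 = k' f 0 -> L k' f <= L k f.
Proof.
move=> k0 kk kf; rewrite !total_allE; apply: ler_sum => e _.
rewrite /term -kf.
have le g : side_curvature (k f 0) (k' g 0) (Phi e) <=
    side_curvature (k f 0) (k g 0) (Phi e) by exact: side_curvature_nincr.
by apply: lerD; case: ifP.
Qed.

Lemma total_curvature_le k f : (forall g, 0 <= k g 0) ->
  L k f <= 2 * #|edge D|%:R * pi * k f 0.
Proof.
move=> k0; rewrite total_allE.
apply: (@le_trans _ _ (\sum_(e : edge D) 2 * pi * k f 0)); last first.
  by rewrite sumr_const -mulr_natr cardT -cardE; lra.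
apply: ler_sum => e _; have pk : 0 <= pi * k f 0 by rewrite mulr_ge0// pi_ge0.
have le g : side_curvature (k f 0) (k g 0) (Phi e) <= pi * k f 0.
  exact: side_curvature_le.
have -> : 2 * pi * k f 0 = pi * k f 0 + pi * k f 0 by ring.
by apply: lerD; case: ifP.
Qed.

(** The exponential of [d] bounds the ratio of the curvatures, so that [d] is a sup
    norm of differences of logarithms. *)
Lemma total_curvature_lipschitz k k' f (d : R) : 0 <= d -> 0 < k f 0 -> 0 < k' f 0 ->
  (forall g, 0 <= k g 0) -> (forall g, 0 <= k' g 0) ->
  (forall g, k g 0 <= expR d * k' g 0) -> (forall g, k' g 0 <= expR d * k g 0) ->
  L k f - L k' f <= 16 * #|edge D|%:R * d.
Proof.
move=> d0 kf kf' k0 k0' h h'; rewrite !total_allE -sumrB.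
apply: (@le_trans _ _ (\sum_(e : edge D) 16 * d)); last first.
  by rewrite sumr_const -mulr_natr cardT -cardE; lra.
apply: ler_sum => e _.
have le g : side_curvature (k f 0) (k g 0) (Phi e) -
    side_curvature (k' f 0) (k' g 0) (Phi e) <= 8 * d.
  exact: side_curvature_lipschitz.
have := le (side1 e); have := le (side2 e).
by rewrite /term; case: ifP => _; case: ifP => _; lra.
Qed.

(** Each edge of [F'] contributes one side if its other face is not in [F'], and
    both sides otherwise. *)
Lemma sum_total_curvature_ge k (F' : {set 'I_n}) (B ep : R) : 0 < ep -> 0 <= B ->
  (forall f, f \in F' -> 1 <= ep * k f 0) -> (forall f, f \notin F' -> 0 <= k f 0 <= B) ->
  \sum_(e in edges_of_set F') side_lower (Phi e) B ep <= \sum_(f in F') L k f.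
Proof.
move=> e0 B0 kF kF'; under [leRHS]eq_bigr do rewrite total_allE.
rewrite exchange_big/= [leLHS]big_mkcond/=; apply: ler_sum => e _.
have k0 f : 0 <= k f 0.
  have [fF|/kF'/andP[]//] := boolP (f \in F').
  by rewrite -(pmulr_rge0 _ e0) (le_trans _ (kF f fF)).
have s0 f g : 0 <= side_curvature (k f 0) (k g 0) (Phi e).
  have := k0 f; rewrite le_eqVlt => /predU1P[<-|kf].
    by rewrite /side_curvature mulr0.
  exact/ltW/side_curvature_gt0.
rewrite big_split/= -!big_mkcondr/=.
have sE (a : 'I_n) (h : 'I_n -> R) : \sum_(f in F' | a == f) h f = if a \in F' then h a else 0.
  have [aF|aF] := ifPn.
    rewrite (big_pred1 a)// => f; rewrite inE eq_sym /=.
    by have [->|] := eqVneq f a; rewrite ?aF ?andbF.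
  by rewrite big1// => f /andP[fF /eqP af]; rewrite af fF in aF.
rewrite !sE; case: ifPn; last first.
  by move=> _; apply: addr_ge0; case: ifP.
rewrite inE => /existsP[f /andP[fF]]; rewrite mem_edges_of.
have [F1|F1] := boolP (side1 e \in F'); have [F2|F2] := boolP (side2 e \in F') => sf.
- by apply: side_curvatures_ge; rewrite ?kF.
- by rewrite addr0; apply: side_curvature_ge; rewrite ?kF ?kF'.
- by rewrite add0r; apply: side_curvature_ge; rewrite ?kF ?kF'.
- by case/orP: sf => /eqP fE; rewrite fE fF in F1 F2.
Qed.

End TotalCurvature.

(** * Equilibria of cooperative systems *)

Section Cooperative.
Context {R : realType} {m : nat}.
Implicit Types (G : ('I_m -> R) -> 'I_m -> R) (x y b : 'I_m -> R) (C d e M B : R).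

Definition offdiag_nincr G := forall x y i,
  (forall j, x j <= y j) -> x i = y i -> G y i <= G x i.

Definition shift_incr G := forall x i d, 0 < d -> G x i < G (fun j => x j + d) i.

Definition sup_lipschitz C G := forall x y d i,
  (forall j, `|x j - y j| <= d) -> G x i - G y i <= C * d.

(** When the coordinates in [U] tend to infinity and the other ones stay bounded above,
    the inequalities [G x j <= b j] cannot all survive. *)
Definition coercive G b := forall (U : {set 'I_m}) B, U != finset.set0 -> exists M,
  forall x, (forall j, j \in U -> M <= x j) -> (forall j, j \notin U -> x j <= B) ->
  exists j, b j < G x j.

(** At an index where [x - y] is maximal, with maximum [d > 0], [x] lies below
    [y + d] and touches it there. *)
Lemma comparison G x y : offdiag_nincr G -> shift_incr G ->
  (forall j, G x j <= G y j) -> forall j, x j <= y j.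
Proof.
move=> Gn Gs le i0; rewrite leNgt; apply/negP => lt0.
pose i := [arg max_(i > i0) (x i - y i)]%O.
have imax j : x j - y j <= x i - y i.
  by rewrite /i; case: arg_maxP => // i1 _ /(_ j isT).
have d0 : 0 < x i - y i by rewrite (lt_le_trans _ (imax i0))// subr_gt0.
have /lt_geF := Gs y i _ d0.
suff -> : G (fun j => y j + (x i - y i)) i <= G y i by [].
apply: le_trans (le i); apply: Gn => [j|]; last by lra.
by have := imax j; lra.
Qed.

Section Perron.
Variables (G : ('I_m -> R) -> 'I_m -> R) (b : 'I_m -> R) (C : R).
Hypotheses (Gn : offdiag_nincr G) (C0 : 0 < C) (Gl : sup_lipschitz C G).

Let sub : set ('I_m -> R) := [set x | forall j, G x j <= b j].

Let sub_max x y : sub x -> sub y -> sub (fun j => Num.max (x j) (y j)).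
Proof.
move=> Ax Ay j; have [xy|xy] := leP (x j) (y j).
  apply: le_trans (Ay j); apply: Gn => [l|]; first by rewrite le_max lexx orbT.
  by rewrite max_r.
apply: le_trans (Ax j); apply: Gn => [l|]; first by rewrite le_max lexx.
by rewrite max_l// ltW.
Qed.

(** If the set [U] of the unbounded coordinates were not empty, maxima of finitely
    many subsolutions would be subsolutions large on all of [U] at once. *)
Let sub_bounded : coercive G b -> (exists x, sub x) ->
  forall j, exists B, forall x, sub x -> x j <= B.
Proof.
move=> Gc [x0 A0].
pose U : {set 'I_m} := [set j | `[< forall M, exists2 x, sub x & M <= x j >]]%SET.
have bndU j : j \notin U -> exists B, forall x, sub x -> x j <= B.
  rewrite inE => /asboolPn/existsNP[B /forall2NP hB]; exists B => x Ax.
  by have [//|/negP] := hB x; rewrite -ltNge => /ltW.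
have [U0|U0] := eqVneq U finset.set0.
  by move=> j; apply: bndU; rewrite U0 inE.
exfalso.
have /choice[B hB] j : exists B, j \notin U -> forall x, sub x -> x j <= B.
  have [jU|/bndU[B hB]] := boolP (j \in U); first by exists 0.
  by exists B.
have [M hM] := Gc U (\sum_j `|B j|) U0.
have [x Ax Mx] : exists2 x, sub x & forall j, j \in enum U -> M <= x j.
  have : {subset enum U <= U} by move=> j; rewrite mem_enum.
  elim: (enum U) => [_|j s IHs sU]; first by exists x0.
  have [|x Ax xs] := IHs; first by move=> l ls; apply: sU; rewrite inE ls orbT.
  have := sU j; rewrite inE eqxx => /(_ isT); rewrite inE => /asboolP/(_ M)[y Ay yM].
  exists (fun j => Num.max (x j) (y j)); first exact: sub_max.
  move=> l; rewrite inE => /predU1P[->|/xs xl]; first by rewrite le_max yM orbT.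
  by rewrite le_max xl.
have [||j] := hM x.
- by move=> j jU; apply: Mx; rewrite mem_enum.
- move=> j jU; apply: (le_trans (hB j jU x Ax)); apply: (le_trans (ler_norm _)).
  by rewrite (bigD1 j)//= lerDl sumr_ge0.
- by rewrite ltNge Ax.
Qed.

(** Perron's method: the subsolutions, closed under maxima because [G] is
    nonincreasing off the diagonal, are bounded above by coercivity, and their
    supremum is a solution. *)
Lemma perron_solution : coercive G b -> (exists x, forall j, G x j <= b j) ->
  exists x, forall j, G x j = b j.
Proof.
move=> Gc sub0; have /choice[B hB] := sub_bounded Gc sub0.
have [x0 A0] := sub0.
pose E j := [set x j | x in sub].
have supE j : has_sup (E j).
  split; first by exists (x0 j), x0.
  by exists (B j) => _ [x Ax <-]; exact: hB.
pose s j := sup (E j).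
have ub x j : sub x -> x j <= s j.
  by move=> Ax; apply: sup_upper_bound => //; exists x.
have As : sub s.
  move=> i; rewrite leNgt; apply/negP => lt.
  (* Take a subsolution [x] with [x i] close to [s i] and raise its other coordinates
     to [s]: [G _ i] can only decrease, and it ends up close to [G s i]. *)
  pose d := (G s i - b i) / (2 * C).
  have d0 : 0 < d by rewrite divr_gt0 ?subr_gt0// mulr_gt0.
  have [_ [x Ax <-] xi] := sup_adherent d0 (supE i).
  pose y j := if j == i then x i else s j.
  have yx : G y i <= b i.
    apply: le_trans (Ax i); apply: Gn; last by rewrite /y eqxx.
    by move=> j; rewrite /y; case: eqVneq => [->//|_]; exact: ub.
  have : G s i - G y i <= C * d.
    apply: Gl => j; rewrite /y; case: eqVneq => [->|_].
      by rewrite ger0_norm ?subr_ge0 ?ub//; rewrite -/(s i) in xi; lra.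
    by rewrite subrr normr0 ltW.
  have -> : C * d = (G s i - b i) / 2 by rewrite /d; field; rewrite gt_eqF.
  lra.
exists s => i; apply/eqP; rewrite eq_le As/= leNgt; apply/negP => lt.
(* Otherwise raising [s i] alone would give a larger subsolution. *)
pose d := (b i - G s i) / C.
have d0 : 0 < d by rewrite divr_gt0 ?subr_gt0.
pose y j := if j == i then s i + d else s j.
suff /(ub y i) : sub y by rewrite /y eqxx; lra.
have sy j : s j <= y j by rewrite /y; case: eqVneq => [->|_//]; rewrite lerDl ltW.
move=> j; have [->|ji] := eqVneq j i.
  have : G y i - G s i <= C * d.
    apply: Gl => l; rewrite /y; case: eqVneq => [->|_].
      by rewrite addrC addKr gtr0_norm.
    by rewrite subrr normr0 ltW.
  have -> : C * d = b i - G s i by rewrite /d; field; rewrite gt_eqF.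
  lra.
by apply: le_trans (As j); apply: Gn => //; rewrite /y ifN.
Qed.

End Perron.
End Cooperative.

(** * Convergence of cooperative flows *)

Section FirstTouch.
Context {R : realType}.
Implicit Types (x t s h d : R).

Lemma derive_lt0_right (f : R -> R) x (d : R) : is_derive x 1 f d -> d < 0 ->
  \forall h \near 0^'+, f (x + h) < f x.
Proof.
move=> [fx fd] d0.
have : (h^-1 *: ((f \o shift x) (h *: 1) - f x)) @[h --> 0^'] --> d.
  by rewrite -fd; exact: fx.
move=> /cvgr_lt/(_ _ d0); rewrite /at_right !near_withinE => near0.
near=> h => h0.
have : h^-1 *: ((f \o shift x) (h *: 1) - f x) < 0.
  move: h0; near: h; apply: filterS near0 => h nh h0; apply: nh.
  by rewrite gt_eqF.
by rewrite /= [h *: 1]mulr1 /GRing.scale/= pmulr_rlt0 ?invr_gt0// subr_lt0 addrC.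
Unshelve. all: by end_near. Qed.

(** Consider the supremum of the times up to which all functions are nonpositive:
    by continuity they still are at that time, and for a short time after it. *)
Lemma first_touch m (D Dd : 'I_m -> R -> R) :
  (forall j t, 0 <= t -> is_derive t 1 (D j) (Dd j t)) ->
  (forall j, D j 0 <= 0) ->
  (forall j t, 0 <= t -> (forall l, D l t <= 0) -> D j t = 0 -> Dd j t < 0) ->
  forall j t, 0 <= t -> D j t <= 0.
Proof.
move=> dD D0 touch j t1 t10; rewrite leNgt; apply/negP => Dt1.
pose E := [set t | 0 <= t /\ forall s, 0 <= s <= t -> forall l, D l s <= 0].
have E0 : E 0 by split=> // s; rewrite -eq_le => /eqP <-.
have Eub : ubound E t1.
  move=> t [t0 tE]; rewrite leNgt; apply/negP => tt.
  by move: Dt1; rewrite ltNge tE// t10 ltW.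
have supE : has_sup E by split; [exists 0|exists t1].
pose tau := sup E.
have tau0 : 0 <= tau by exact: sup_upper_bound.
have before s l : 0 <= s -> s < tau -> D l s <= 0.
  move=> s0 stau.
  have ts0 : 0 < tau - s by rewrite subr_gt0.
  have [t [t0 tE] st] := sup_adherent ts0 supE.
  by apply: tE; rewrite s0 ltW//; move: st; rewrite -/tau; lra.
have cD l : {for tau, continuous (D l)} by exact: is_derive_continuous (dD l _ tau0).
have attau l : D l tau <= 0.
  rewrite leNgt; apply/negP => Dl.
  have t0 : 0 < tau.
    by rewrite lt_neqAle tau0 andbT; apply/eqP => t0; rewrite -t0 ltNge D0 in Dl.
  have /cvgr_gt/(_ _ Dl)/nbhs_ballP[d /= d0 dD'] := cD l.
  pose s := Num.max 0 (tau - d / 2).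
  have st : s < tau by rewrite gt_max t0 gtrBl divr_gt0.
  have : 0 < D l s.
    apply: dD'; rewrite /ball/= gtr0_norm ?subr_gt0// ltrBlDl -ltrBlDr lt_max.
    by apply/orP; right; lra.
  by rewrite ltNge before// le_max lexx.
have : \forall h \near 0^'+, forall l, D l (tau + h) <= 0.
  apply: filter_forall => l.
  have := attau l; rewrite le_eqVlt => /predU1P[Dl|Dl].
    have := derive_lt0_right (dD l _ tau0) (touch l _ tau0 attau Dl).
    by apply: filterS => h /ltW; rewrite Dl.
  have /cvgr_lt/(_ _ Dl)/nbhs_ballP[d /= d0 dD'] := cD l.
  near=> h; apply/ltW/dD'; rewrite /ball/= opprD addNKr normrN.
  have h0 : 0 < h by [].
  by rewrite gtr0_norm.
rewrite /at_right near_withinE => /nbhs_ballP[d /= d0 after].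
suff : E (tau + d / 2).
  by move=> /(sup_upper_bound supE); rewrite -/tau; lra.
split; first by rewrite addr_ge0// divr_ge0// ltW.
move=> s /andP[s0 sd] l; have [/before|st|->//] := ltgtP s tau; first exact.
have -> : s = tau + (s - tau) by ring.
apply: after; last by rewrite subr_gt0.
by rewrite /ball/= sub0r normrN gtr0_norm ?subr_gt0//; lra.
Unshelve. all: by end_near. Qed.

End FirstTouch.

Section Convergence.
Context {R : realType} {m : nat}.
Implicit Types (G : ('I_m -> R) -> 'I_m -> R) (x : R -> 'I_m -> R) (b y : 'I_m -> R).

(** The barrier is [y + e / 2 + s0 * expR (- k * t)].  A solution touching it from below
    at index [j] has derivative at most [- eta] there, where [eta > 0] bounds from below
    the growth of every [G _ j] under the shift by [e / 2]; the barrier decreases at most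
    at the rate [eta / 2] by the choice of [k]. *)
Lemma upper_barrier G b y x (e : R) :
  offdiag_nincr G -> shift_incr G -> (forall j, G y j = b j) ->
  (forall j (t : R), 0 <= t -> is_derive t 1 (x^~ j) (- (G (x t) j - b j))) ->
  0 < e -> exists2 T : R, 0 <= T & forall t, T <= t -> forall j, x t j <= y j + e.
Proof.
move=> Gn Gs yb dx e0; pose e2 := e / 2; have e20 : 0 < e2 by rewrite divr_gt0.
pose eta := \big[Num.min/1]_j (G (fun l => y l + e2) j - b j).
have eta0 : 0 < eta.
  apply: (big_ind (fun r : R => 0 < r)) => // [r s r0 s0|j _].
    by rewrite lt_min r0.
  by rewrite subr_gt0 -yb Gs.
have etaP j : eta <= G (fun l => y l + e2) j - b j by exact: bigmin_le_cond.
pose s0 := 1 + \sum_j `|x 0 j - y j|.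
have s00 : 0 < s0 by rewrite ltr_pwDl// sumr_ge0.
pose k := eta / (2 * s0); have k0 : 0 < k by rewrite divr_gt0// mulr_gt0.
pose bar t := e2 + s0 * expR (- k * t).
pose dbar t := - (k * s0 * expR (- k * t)).
have dbarP (t : R) : is_derive t 1 bar (dbar t).
  have de : is_derive t 1 (fun t : R => expR (- k * t)) (expR (- k * t) * (- k)).
    apply: (@is_derive1_comp R expR (fun t : R => - k * t)).
    by apply: is_derive_eq; rewrite [_ *: _]mulr1.
  by apply: is_derive_eq; rewrite /dbar /GRing.scale/=; ring.
have below j t : 0 <= t -> x t j <= y j + bar t.
  move=> t0; rewrite -subr_le0.
  apply: (@first_touch R m (fun j t => x t j - (y j + bar t))
    (fun j t => - (G (x t) j - b j) - (0 + dbar t))) => // {j t t0}.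
  - move=> j t t0; have := dx j t t0; have := dbarP t => ? ?.
    exact: is_deriveB.
  - move=> j; rewrite subr_le0 /bar mulr0 expR0 mulr1.
    rewrite /s0 (bigD1 j)//=; have := ler_norm (x 0 j - y j).
    have : 0 <= \sum_(i < m | i != j) `|x 0 i - y i| by rewrite sumr_ge0.
    lra.
  - move=> j t t0 le /eqP; rewrite subr_eq0 => /eqP eq.
    have ex0 := expR_gt0 (- k * t).
    have ex1 : expR (- k * t) <= 1 by rewrite expR_le1 mulNr oppr_le0 mulr_ge0// ltW.
    have h1 : G (fun l => y l + e2) j < G (fun l => y l + bar t) j.
      have -> : (fun l => y l + bar t) = (fun l => (y l + e2) + (bar t - e2)).
        by apply/funext => l; ring.
      by apply: Gs; rewrite /bar addrC addKr mulr_gt0.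
    have h2 : G (fun l => y l + bar t) j <= G (x t) j.
      by apply: Gn => // l; have := le l; rewrite subr_le0.
    have h3 : k * s0 * expR (- k * t) <= eta / 2.
      have -> : eta / 2 = k * s0 * 1 by rewrite /k; field; rewrite gt_eqF.
      by rewrite ler_pM2l// mulr_gt0.
    have := etaP j; rewrite /dbar; lra.
have T0 : 0 <= s0 / (e2 * k) by apply/ltW/divr_gt0 => //; exact: mulr_gt0.
exists (s0 / (e2 * k)) => // t tT j; have t0 := le_trans T0 tT.
apply: (le_trans (below j t t0)); rewrite lerD2l /bar.
suff : s0 * expR (- k * t) <= e2 by rewrite /e2; lra.
rewrite mulNr expRN ler_pdivrMr ?expR_gt0//.
have : s0 <= e2 * (k * t).
  have ek : 0 < e2 * k by exact: mulr_gt0.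
  by move: tT; rewrite (ler_pdivrMr _ _ ek) => /le_trans; apply; lra.
move=> /le_trans; apply; rewrite ler_pM2l//.
by apply: le_trans (expR_ge1Dx _); rewrite lerDr.
Qed.

(** The lower barrier is the upper one for [x |-> - G (- x)]. *)
Lemma flow_converges G b y x :
  offdiag_nincr G -> shift_incr G -> (forall j, G y j = b j) ->
  (forall j (t : R), 0 <= t -> is_derive t 1 (x^~ j) (- (G (x t) j - b j))) ->
  forall j, x t j @[t --> +oo] --> y j.
Proof.
move=> Gn Gs yb dx j; apply/cvgrPdist_le => e e0.
have [T T0 hT] := upper_barrier Gn Gs yb dx e0.
pose H (z : 'I_m -> R) l := - G (fun i => - z i) l.
have Hn : offdiag_nincr H.
  by move=> z w i zw zwi; rewrite lerN2; apply: Gn => [l|]; rewrite ?lerN2 ?zwi.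
have Hs : shift_incr H.
  move=> z i d d0; rewrite ltrN2.
  have := Gs (fun l => - (z l + d)) i d d0.
  by congr (_ < G _ _); apply/funext => l; ring.
have Hy l : H (fun i => - y i) l = - b l.
  by rewrite /H -yb; congr (- G _ _); apply/funext => i; rewrite opprK.
have dHx l (t : R) : 0 <= t ->
    is_derive t 1 (fun s => - x s l) (- (H (fun i => - x t i) l - - b l)).
  move=> t0; have -> : H (fun i => - x t i) l = - G (x t) l.
    by congr (- G _ _); apply/funext => i; rewrite opprK.
  by rewrite -opprD; apply: is_deriveN; exact: dx.
have [T' T0' hT'] := upper_barrier Hn Hs Hy dHx e0.
near=> t.
have tT : T <= t by [].
have tT' : T' <= t by [].
by rewrite ler_norml; have := hT t tT j; have := hT' t tT' j; lra.
Unshelve. all: by end_near. Qed.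

End Convergence.

(** * Global solutions of Lipschitz equations *)

Section Primitive.
Context {R : realType}.
Implicit Types (g h : R -> R) (s t C k B : R).

(** Integrating from [-1] rather than [0] makes the primitive differentiable on
    both sides at time [0]. *)
Definition primitive g t : R :=
  (\int[lebesgue_measure]_(s in `[-1, t]) g s - \int[lebesgue_measure]_(s in `[-1, 0]) g s)%R.

Lemma primitive0 g : primitive g 0 = 0.
Proof. exact: subrr. Qed.

Lemma is_derive_primitive g t : continuous g -> -1 < t -> is_derive t 1 (primitive g) (g t).
Proof.
move=> gc t1; have tt : t < t + 1 by rewrite ltrDl.
have gi : lebesgue_measure.-integrable `[-1, t + 1] (EFin \o g).
  by apply: continuous_compact_integrable; [exact: segment_compact|exact: continuous_subspaceT].
have [dI eI] := continuous_FTC1_closed tt gi t1 (gc t).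
have dI' : is_derive t 1 (fun t => \int[lebesgue_measure]_(s in `[-1, t]) g s)%R (g t).
  by split=> //; rewrite -derive1E.
by apply: is_derive_eq; rewrite subr0.
Qed.

(** Contraction estimate in the norm weighted by [expR (- k * t)]: integration gains a
    factor [1 / k]. *)
Lemma primitive_le g h C k t : continuous g -> continuous h -> 0 < k -> 0 <= t ->
  (forall s, 0 <= s -> `|g s - h s| <= C * k * expR (k * s)) ->
  `|primitive g t - primitive h t| <= C * expR (k * t).
Proof.
move=> gc hc k0 t0 le.
have C0 : 0 <= C.
  have := le 0 (lexx _); rewrite mulr0 expR0 mulr1 => /(le_trans (normr_ge0 _)).
  by rewrite pmulr_lge0.
have dE (s : R) : is_derive s 1 (fun s : R => C * expR (k * s)) (C * k * expR (k * s)).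
  have de : is_derive s 1 (fun s : R => expR (k * s)) (expR (k * s) * k).
    apply: (@is_derive1_comp R expR (fun t : R => k * t)).
    by apply: is_derive_eq; rewrite [_ *: _]mulr1.
  by apply: is_derive_eq; rewrite /GRing.scale/=; ring.
have dD (s : R) : 0 <= s <= t ->
    is_derive s 1 (fun s => primitive g s - primitive h s) (g s - h s).
  move=> /andP[s0 _]; have s1 : -1 < s by apply: lt_le_trans s0; rewrite ltrN10.
  by apply: is_deriveB; exact: is_derive_primitive.
have dDN (s : R) : 0 <= s <= t ->
    is_derive s 1 (fun s => - (primitive g s - primitive h s)) (- (g s - h s)).
  by move=> s0; have ? := dD s s0; exact: is_deriveN.
have u := increment_le_cc t0 dD (fun s _ => dE s).
have v := increment_le_cc t0 dDN (fun s _ => dE s).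
rewrite !primitive0 !subr0 mulr0 expR0 mulr1 in u v.
rewrite ler_norml; apply/andP; split.
  rewrite lerNl; apply: (@le_trans _ _ (C * expR (k * t) - C)); last by rewrite gerBl.
  rewrite -[leLHS]subr0 -oppr0; apply: v => s /andP[s0 _].
  by apply: le_trans (le s s0); rewrite -normrN ler_norm.
apply: (@le_trans _ _ (C * expR (k * t) - C)); last by rewrite gerBl.
by apply: u => s /andP[s0 _]; apply: le_trans (le s s0); rewrite ler_norm.
Qed.

(** A sequence with geometrically small increments lies in the nested intervals of
    center [u p] and radius [2 * B / 2 ^+ p]. *)
Lemma geometric_limit (u : nat -> R) B :
  (forall p, `|u p.+1 - u p| <= B / 2 ^+ p) ->
  exists l, forall p, `|u p - l| <= 2 * B / 2 ^+ p.
Proof.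
move=> uB; pose r p := 2 * B / 2 ^+ p.
have rS p : r p.+1 = r p / 2 by rewrite /r exprS; field; rewrite expf_neq0.
have Br p : B / 2 ^+ p = r p / 2 by rewrite /r; field; rewrite expf_neq0.
have r0 p : 0 <= r p.
  by have := le_trans (normr_ge0 _) (uB p); rewrite Br; lra.
have lo p q : u p - r p <= u (p + q)%N - r (p + q)%N.
  elim: q => [|q IHq]; first by rewrite addn0.
  have := uB (p + q)%N; rewrite addnS rS ler_norml Br; lra.
have hi p q : u (p + q)%N + r (p + q)%N <= u p + r p.
  elim: q => [|q IHq]; first by rewrite addn0.
  have := uB (p + q)%N; rewrite addnS rS ler_norml Br; lra.
have cross p q : u p - r p <= u q + r q.
  have := lo p q; have := hi q p; have := r0 (p + q)%N; rewrite [(q + p)%N]addnC; lra.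
pose E := [set u p - r p | p in [set: nat]].
have Eub p : ubound E (u p + r p) by move=> _ [q _ <-]; exact: cross.
have supE : has_sup E by split; [exists (u 0%N - r 0%N), 0%N|exists (u 0%N + r 0%N)].
exists (sup E) => p; rewrite -/(r p) ler_norml.
have : u p - r p <= sup E by apply: sup_upper_bound => //; exists p.
have : sup E <= u p + r p by apply: ge_sup => //; exact: supE.1.
by lra.
Qed.

End Primitive.

Section Picard.
Context {R : realType} {m : nat}.
Variables (F : ('I_m -> R) -> 'I_m -> R) (C : R) (a : 'I_m -> R).
Hypotheses (C0 : 0 < C) (Fl : sup_lipschitz C F).
Implicit Types (t s : R) (w : 'I_m -> R -> R).

Let Fabs x y d j : (forall l, `|x l - y l| <= d) -> `|F x j - F y j| <= C * d.
Proof.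
move=> xy; rewrite ler_norml Fl// andbT lerNl opprB.
by apply: Fl => l; rewrite distrC.
Qed.

Let continuous_field w : (forall l, continuous (w l)) ->
  forall j, continuous (fun s => F (w^~ s) j).
Proof.
move=> wc j s; apply/cvgrPdist_le => e e0.
have eC : 0 < e / C by rewrite divr_gt0.
have : \forall s' \near s, forall l, `|w l s - w l s'| <= e / C.
  apply: (@filter_forall _ _ (fun l s' => `|w l s - w l s'| <= e / C) (nbhs s)) => l; have /cvgrPdist_le/(_ _ eC) := wc l s; apply.
apply: filterS => s' le; apply: (le_trans (Fabs j le)).
by rewrite mulrC divfK ?gt_eqF.
Qed.

(** The time is truncated at [0], so that the iterates are continuous functions on the
    whole line, constant on the negative times. *)
Fixpoint picard p : 'I_m -> R -> R :=
  if p is q.+1 then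
    fun j t => a j + primitive (fun s => F ((picard q)^~ s) j) (Num.max 0 t)
  else fun j _ => a j.

Let picardS p j t : picard p.+1 j t =
  a j + primitive (fun s => F ((picard p)^~ s) j) (Num.max 0 t).
Proof. by []. Qed.

Let max_gtN1 t : -1 < Num.max 0 t.
Proof. by rewrite lt_max ltrN10. Qed.

Let continuous_picard p j : continuous (picard p j).
Proof.
elim: p j => [|p IHp] j /= t; first exact: cvg_cst.
set g := primitive _.
have mc : {for t, continuous (Num.max (0 : R))}.
  by apply: (@continuous_max R R (cst 0) id t); [exact: cvg_cst|exact: cvg_id].
have gc : {for Num.max 0 t, continuous g}.
  exact/is_derive_continuous/is_derive_primitive/max_gtN1/continuous_field.
by apply: cvgD; [exact: cvg_cst|exact: (continuous_comp mc gc)].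
Qed.

Let picard_max p j t : picard p j (Num.max 0 t) = picard p j t.
Proof. by case: p => //= p; rewrite maxA maxxx. Qed.

Let k := 2 * C.
Let k0 : 0 < k. Proof. exact: mulr_gt0. Qed.
Let B := \sum_j `|F a j| / k.

Let B0 : 0 <= B.
Proof. by rewrite sumr_ge0// => j _; rewrite divr_ge0// ltW. Qed.

Let picard_increment p j t :
  `|picard p.+1 j t - picard p j t| <= B * expR (k * Num.max 0 t) / 2 ^+ p.
Proof.
rewrite -picard_max -[in X in _ - X]picard_max.
have : 0 <= Num.max 0 t by rewrite le_max lexx.
move: (Num.max 0 t) => {}t; elim: p j t => [|p IHp] j t t0.
  have -> : picard 1 j t - picard 0 j t =
      primitive (fun=> F a j) t - primitive (fun=> 0) t.
    rewrite /= (max_r t0) addrC addKr.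
    have -> : primitive (fun=> 0) t = 0 :> R.
      by rewrite /primitive !Rintegral_cst// !mul0r subrr.
    by rewrite subr0.
  rewrite expr0 divr1; apply: primitive_le => //; try (by move=> s; exact: cvg_cst).
  move=> s s0; rewrite subr0; apply: (@le_trans _ _ (B * k)).
    rewrite /B mulr_suml (bigD1 j)//= divfK ?gt_eqF// lerDl sumr_ge0// => l _.
    by rewrite mulr_ge0// ?divr_ge0// ltW.
  have Bk : 0 <= B * k by apply: mulr_ge0 => //; exact: ltW.
  by apply: (ler_peMr Bk); rewrite -expR0 ler_expR mulr_ge0// ltW.
rewrite [picard p.+2 _ _]picardS [picard p.+1 j t]picardS (max_r t0).
rewrite opprD addrACA subrr add0r.
have -> : B * expR (k * t) / 2 ^+ p.+1 = (B / 2 ^+ p.+1) * expR (k * t) by ring.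
apply: (@primitive_le _ _ _ (B / 2 ^+ p.+1) k) => //; try exact: continuous_field.
move=> s s0; have -> : B / 2 ^+ p.+1 * k * expR (k * s) = C * (B * expR (k * s) / 2 ^+ p).
  by rewrite exprS /k; field; rewrite expf_neq0.
by apply: Fabs => l; have := IHp l s s0.
Qed.

Let small_geometric (A e : R) : 0 < e -> exists p, A / 2 ^+ p <= e.
Proof.
move=> e0; exists (Num.bound (A / e)).
have /ltW := @Num.Theory.upper_nthrootP R (A / e) _ (leqnn _).
by rewrite ler_pdivrMr// mulrC -ler_pdivrMr// exprn_gt0.
Qed.

(** The Picard iterates differ by at most [B * expR (k * t) / 2 ^+ p], hence
    converge locally uniformly, and the equation passes to the limit. *)
Lemma global_solution : exists x : R -> 'I_m -> R, (forall j, x 0 j = a j) /\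
  forall j t, 0 <= t -> is_derive t 1 (x^~ j) (F (x t) j).
Proof.
have /choice[w' hw'] (jt : 'I_m * R) := geometric_limit (fun p => picard_increment p jt.1 jt.2).
pose w j t := w' (j, t).
pose A t := 2 * (B * expR (k * Num.max 0 t)).
have hw j t p : `|picard p j t - w j t| <= A t / 2 ^+ p by exact: hw' (j, t) p.
have A0 t : 0 <= A t by rewrite mulr_ge0// mulr_ge0// expR_ge0.
have wc j : continuous (w j).
  move=> t; apply/cvgrPdist_le => e e0.
  have e3 : 0 < e / 3 by rewrite divr_gt0.
  have [p hp] := small_geometric (A (`|t| + 1)) e3.
  have Ale s : s <= `|t| + 1 -> `|picard p j s - w j s| <= e / 3.
    move=> st; apply: le_trans hp; apply: (le_trans (hw j s p)).
    rewrite ler_pM2r ?invr_gt0 ?exprn_gt0// ler_pM2l// ler_wpM2l// ler_expR.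
    by rewrite ler_pM2l// ge_max le_max lexx/= le_max st orbT.
  have /cvgrPdist_le/(_ _ e3) pc := @continuous_picard p j t.
  near=> s.
  have st : s <= `|t| + 1.
    apply: ltW; near: s; apply: lt_nbhsl.
    by rewrite (le_lt_trans (ler_norm t))// ltrDl.
  have h1 : `|picard p j t - picard p j s| <= e / 3 by near: s.
  have h2 := Ale s st.
  have h3 : `|picard p j t - w j t| <= e / 3.
    by apply: Ale; rewrite (le_trans (ler_norm t))// lerDl.
  rewrite ler_norml in h1; rewrite ler_norml in h2; rewrite ler_norml in h3.
  by rewrite ler_norml; lra.
pose x t j := a j + primitive (fun s => F (w^~ s) j) t.
have wx t : 0 <= t -> w^~ t = x t.
  move=> t0; apply/funext => j; apply/eqP; rewrite -subr_eq0 -normr_le0.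
  apply/ler_addgt0Pl => e e0; rewrite addr0.
  have [p hp] := small_geometric (A t) e0; apply: le_trans hp.
  have h1 := hw j t p.+1.
  have AE : A t = 2 * (B * expR (k * t)) by rewrite /A max_r.
  have h2 : `|picard p.+1 j t - x t j| <= A t / 2 ^+ p.+1.
    rewrite picardS (max_r t0) /x opprD addrACA subrr add0r.
    have -> : A t / 2 ^+ p.+1 = (2 * B / 2 ^+ p.+1) * expR (k * t) by rewrite AE; ring.
    apply: (@primitive_le _ _ _ (2 * B / 2 ^+ p.+1) k) => //;
      try exact: continuous_field.
    move=> s s0; have -> : 2 * B / 2 ^+ p.+1 * k * expR (k * s) = C * (A s / 2 ^+ p).
      by rewrite /A (max_r s0) exprS /k; field; rewrite expf_neq0.
    by apply: Fabs => l; exact: hw.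
  have -> : A t / 2 ^+ p = A t / 2 ^+ p.+1 + A t / 2 ^+ p.+1.
    by rewrite exprS; field; rewrite expf_neq0.
  by rewrite ler_norml in h1; rewrite ler_norml in h2; rewrite ler_norml; lra.
exists x; split=> [j|j t t0]; first by rewrite /x primitive0 addr0.
rewrite -wx//.
have dP : is_derive t 1 (primitive (fun s => F (w^~ s) j)) (F (w^~ t) j).
  apply: is_derive_primitive; first exact: continuous_field.
  by apply: lt_le_trans t0; rewrite ltrN10.
have := @is_deriveD _ _ _ (cst (a j)) _ t 1 _ _ (is_derive_cst _ _ _) dP.
by rewrite add0r.
Unshelve. all: by end_near. Qed.

End Picard.

(** * Uniqueness of solutions *)

Section Uniqueness.
Context {R : realType} {m : nat}.
Implicit Types (F : ('I_m -> R) -> 'I_m -> R) (x y : R -> 'I_m -> R) (a : 'I_m -> R).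

(** The squared distance of two solutions grows at most exponentially. *)
Lemma solution_unique F (C T : R) x y a : 0 < C -> sup_lipschitz C F -> 0 < T ->
  (forall j, x 0 j = a j) -> (forall j, y 0 j = a j) ->
  (forall j, x t j @[t --> 0^'+] --> a j) -> (forall j, y t j @[t --> 0^'+] --> a j) ->
  (forall j (t : R), 0 < t <= T -> is_derive t 1 (x^~ j) (F (x t) j)) ->
  (forall j (t : R), 0 < t <= T -> is_derive t 1 (y^~ j) (F (y t) j)) ->
  forall j, x T j = y T j.
Proof.
move=> C0 Fl T0 x0 y0 xc yc dx dy.
pose S t := \sum_j (x t j - y t j) ^+ 2.
pose dS t := \sum_j 2 * (x t j - y t j) * (F (x t) j - F (y t) j).
have S0 t : 0 <= S t by rewrite sumr_ge0// => j _; exact: sqr_ge0.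
pose K := 2 * m%:R * C.
have dSP (t : R) : 0 < t <= T -> is_derive t 1 S (dS t).
  move=> tT; have -> : S = \sum_j (fun t => (x t j - y t j) ^+ 2).
    by apply/funext => s; rewrite fct_sumE.
  apply: is_derive_sum => j; have ? := dx j t tT; have ? := dy j t tT.
  by apply: is_derive_eq; rewrite /GRing.scale/=; ring.
have dSle t : dS t <= K * S t.
  pose r := Num.sqrt (S t).
  have le j : `|x t j - y t j| <= r.
    rewrite -sqrtr_sqr ler_wsqrtr// /S (bigD1 j)//= lerDl sumr_ge0// => l _.
    exact: sqr_ge0.
  have r0 : 0 <= r := sqrtr_ge0 _.
  have -> : K * S t = \sum_(j < m) 2 * C * S t.
    by rewrite sumr_const card_ord -mulr_natr /K; ring.
  have rr : r * r = S t by rewrite -expr2 sqr_sqrtr.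
  apply: ler_sum => j _; have Fj : `|F (x t) j - F (y t) j| <= C * r.
    rewrite ler_norml Fl// andbT lerNl opprB.
    by apply: Fl => l; rewrite distrC.
  apply: (le_trans (ler_norm _)); rewrite !normrM gtr0_norm// -rr.
  have -> : 2 * C * (r * r) = 2 * (r * (C * r)) by ring.
  by rewrite -mulrA ler_pM2l// ler_pM.
pose E (t : R) := expR (- K * t).
have dE (t : R) : is_derive t 1 E (E t * - K).
  apply: (@is_derive1_comp R expR (fun t => - K * t)).
  by apply: is_derive_eq; rewrite [_ *: _]mulr1.
pose dV t := (dS t - K * S t) * E t.
have dVP (t : R) : 0 < t <= T -> is_derive t 1 (S * E) (dV t).
  move=> tT; have ? := dSP t tT; apply: is_derive_eq.
  by rewrite /dV /GRing.scale/=; ring.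
have S00 : S 0 = 0 by rewrite /S big1// => j _; rewrite x0 y0 subrr expr0n.
have Vc : {within `[0, T], continuous (S * E)}.
  apply/continuous_within_itvP => //; split.
  - move=> t; rewrite in_itv/= => /andP[t0 tT].
    by apply: is_derive_continuous; apply: dVP; rewrite t0 ltW.
  - apply: cvgM; last first.
      exact/cvg_at_right_filter/(is_derive_continuous (dE 0)).
    apply: cvg_big => [|j _]; first exact: add_continuous.
    rewrite x0 y0; under eq_cvg do rewrite expr2.
    by rewrite expr2; apply: cvgM; apply: cvgB.
  - apply: cvg_at_left_filter; apply: is_derive_continuous; apply: dVP.
    by rewrite T0 lexx.
have dc (t : R) : t \in `]0, T[ -> is_derive t 1 (cst 0 : R -> R) 0.
  by move=> _; exact: is_derive_cst.
have cc : {within `[0, T], continuous (cst 0 : R -> R)} by move=> ?; exact: cvg_cst.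
have := increment_le (ltW T0) _ dc Vc cc.
move=> /(_ dV) h; have {h} : (S * E) T - (S * E) 0 <= 0 - 0 :> R.
  apply: h => t; last by rewrite /dV pmulr_lle0 ?expR_gt0// subr_le0.
  by rewrite in_itv/= => /andP[t0 tT]; apply: dVP; rewrite t0 ltW.
have VE t : (S * E) t = S t * E t by [].
rewrite !VE S00 mul0r !subr0 pmulr_lle0 ?expR_gt0// => ST j.
have : (x T j - y T j) ^+ 2 <= 0.
  apply: le_trans ST; rewrite /S (bigD1 j)//= lerDl sumr_ge0// => l _.
  exact: sqr_ge0.
by rewrite real_exprn_even_le0 ?num_real//= subr_eq0 => /eqP.
Qed.

End Uniqueness.

(** * The total curvature in logarithmic coordinates *)

Lemma cvg_mx (R : realType) (T : Type) (F : set_system T) (FF : Filter F) p q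
    (f : T -> 'M[R]_(p, q)) (l : 'M[R]_(p, q)) :
  (forall a b, f t a b @[t --> F] --> l a b) -> f t @[t --> F] --> l.
Proof.
move=> fl; apply/cvgrPdist_le => e e0.
have near_le : \forall t \near F, forall a b, `|l a b - f t a b| <= e.
  apply: (@filter_forall _ _ (fun a t => forall b, `|l a b - f t a b| <= e) F) => a.
  apply: (@filter_forall _ _ (fun b t => `|l a b - f t a b| <= e) F) => b.
  by have /cvgrPdist_le/(_ _ e0) := fl a b.
apply: filterS near_le => t le.
rewrite /Num.norm/= mx_normrE; apply/bigmax_leP; split; first exact: ltW.
by move=> [a b] _; rewrite !mxE.
Qed.

Section LogCoordinates.
Context {R : realType} {S : topologicalType} (D : cell_decomposition R S).
Variable Phi : edge D -> R.
Hypothesis hPhi : forall e, 0 < Phi e < pi / 2.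
Variables (m : nat) (i : 'I_m -> 'I_(nfaces D)).
Hypothesis i_inj : injective i.
Implicit Types (x y : 'I_m -> R) (f : 'I_(nfaces D)) (j : 'I_m).
Local Notation n := (nfaces D).

Definition exp_metric x : 'cV[R]_n := extend0 i (\col_j expR (x j)).

Definition log_curvature x j : R := total_curvature Phi (exp_metric x) (i j).

Lemma extend0_in (kt : 'cV[R]_m) j : extend0 i kt (i j) 0 = kt j 0.
Proof.
rewrite mxE; case: pickP => [j' /eqP/i_inj->//|/(_ j)].
by rewrite eqxx.
Qed.

Lemma extend0_out (kt : 'cV[R]_m) f : f \notin faces_in i -> extend0 i kt f 0 = 0.
Proof.
move=> fi; rewrite mxE; case: pickP => [j /eqP jf|//].
by rewrite -jf imset_f in fi.
Qed.

Lemma exp_metric_in x j : exp_metric x (i j) 0 = expR (x j).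
Proof. by rewrite extend0_in mxE. Qed.

Lemma faces_inP f : f \in faces_in i -> exists j, f = i j.
Proof. by move=> /imsetP[j _ ->]; exists j. Qed.

Lemma exp_metric_ge0 x f : 0 <= exp_metric x f 0.
Proof.
have [/faces_inP[j ->]|/extend0_out->//] := boolP (f \in faces_in i).
by rewrite exp_metric_in expR_ge0.
Qed.

Lemma log_curvature_offdiag : offdiag_nincr log_curvature.
Proof.
move=> x y j xy xyj; apply: total_curvature_nincr => //.
- exact: exp_metric_ge0.
- move=> f; have [/faces_inP[l ->]|fo] := boolP (f \in faces_in i).
    by rewrite !exp_metric_in ler_expR.
  by rewrite /exp_metric !extend0_out.
- by rewrite !exp_metric_in xyj.
Qed.

Lemma exp_metric_shift x (d : R) :
  exp_metric (fun j => x j + d) = expR d *: exp_metric x.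
Proof.
apply/matrixP => f z; rewrite ord1 [RHS]mxE.
have [/faces_inP[l ->]|fo] := boolP (f \in faces_in i).
  by rewrite !exp_metric_in expRD mulrC.
by rewrite /exp_metric !extend0_out// mulr0.
Qed.

Lemma log_curvature_shift : shift_incr log_curvature.
Proof.
move=> x j d d0; rewrite /log_curvature exp_metric_shift.
apply: total_curvature_scale => //; first exact: exp_metric_ge0.
  by rewrite exp_metric_in expR_gt0.
by rewrite expR_gt1.
Qed.

Lemma log_curvature_lipschitz : sup_lipschitz (16 * #|edge D|%:R + 1) log_curvature.
Proof.
move=> x y d j xy; have d0 : 0 <= d := le_trans (normr_ge0 _) (xy j).
have le u v : (forall l, u l - v l <= d) ->
    forall f, exp_metric u f 0 <= expR d * exp_metric v f 0.
  move=> uv f; have [/faces_inP[l ->]|fo] := boolP (f \in faces_in i).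
    by rewrite !exp_metric_in -expRD ler_expR -lerBlDr.
  by rewrite /exp_metric !extend0_out// mulr0.
apply: (@le_trans _ _ (16 * #|edge D|%:R * d)); last by rewrite ler_wpM2r// lerDl.
apply: total_curvature_lipschitz => //; try exact: exp_metric_ge0.
- by rewrite exp_metric_in expR_gt0.
- by rewrite exp_metric_in expR_gt0.
- by apply: le => l; have := xy l; rewrite ler_norml => /andP[].
- by apply: le => l; have := xy l; rewrite ler_norml; lra.
Qed.

Variable Lhat : 'cV[R]_n.
Hypothesis hL : curvature_set Phi i Lhat.

Lemma log_curvature_subsolution : exists x, forall j, log_curvature x j <= Lhat (i j) 0.
Proof.
have [Lpos _ _] := hL; pose c : R := 2 * #|edge D|%:R * pi.
have c0 : 0 <= c by rewrite !mulr_ge0// pi_ge0.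
have c1 : 0 < c + 1 by rewrite ltr_wpDl.
exists (fun j => ln (Lhat (i j) 0 / (c + 1))) => j.
have := total_curvature_le hPhi (i j) (exp_metric_ge0 (fun j => ln (Lhat (i j) 0 / (c + 1)))).
rewrite exp_metric_in lnK ?posrE ?divr_gt0// => /le_trans; apply.
rewrite -/c mulrCA ler_piMr ?(ltW (Lpos j))// ler_pdivrMr// mul1r lerDl.
by [].
Qed.

(** As the curvatures of the faces in [U] go to infinity, the sum of their total
    curvatures is eventually above any number smaller than twice the sum of the
    angles of their edges. *)
Lemma log_curvature_coercive : coercive log_curvature (fun j => Lhat (i j) 0).
Proof.
move=> U B /set0Pn[j0 j0U]; have [Lpos _ LF] := hL.
pose F' : {set 'I_n} := [set i j | j in U]%SET.
have F'0 : F' != finset.set0 by apply/set0Pn; exists (i j0); exact: imset_f.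
have F's : F' \subset faces_in i.
  by apply/fintype.subsetP => _ /imsetP[j _ ->]; exact: imset_f.
have lt0 := LF _ F'0 F's.
pose lower ep := \sum_(e in edges_of_set F') side_lower (Phi e) (expR B) ep.
have lower0 : lower 0 = 2 * \sum_(e in edges_of_set F') Phi e.
  by rewrite mulr_sumr; apply: eq_bigr => e _; rewrite side_lower0.
have lowerc : {for 0, continuous lower}.
  apply: cvg_big => [|e _]; first exact: add_continuous.
  exact: continuous_side_lower.
rewrite -lower0 in lt0.
have /cvgr_gt/(_ _ lt0)/nbhs_ballP[d /= d0 near0] := lowerc.
(* [ep] is the inverse of the smallest geodesic curvature allowed on [U], whose
   logarithm [- ln ep] is the required threshold. *)
pose ep := d / 2; have ep0 : 0 < ep by rewrite divr_gt0.
have ltep : \sum_(f in F') Lhat f 0 < lower ep.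
  by apply: near0; rewrite /ball/= sub0r normrN gtr0_norm// /ep; lra.
exists (- ln ep) => x xU xB; apply: contrapT => /forallNP hle.
have ge : lower ep <= \sum_(f in F') total_curvature Phi (exp_metric x) f.
  apply: (@sum_total_curvature_ge _ _ _ _ hPhi _ _ (expR B)) => //.
  - move=> _ /imsetP[j jU ->]; rewrite exp_metric_in -[ep]lnK ?posrE// -expRD.
    by rewrite -expR0 ler_expR; have := xU j jU; lra.
  - move=> f fF; rewrite exp_metric_ge0/=.
    have [/faces_inP[l fl]|/extend0_out->] := boolP (f \in faces_in i); last exact: expR_ge0.
    rewrite fl exp_metric_in ler_expR; apply: xB; apply: contra fF => lU.
    by rewrite fl imset_f.
have := lt_le_trans ltep ge; rewrite ltNge => /negP; apply.
by apply: ler_sum => _ /imsetP[j _ ->]; rewrite leNgt; apply/negP; exact: hle.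
Qed.

Lemma log_curvature_equilibrium : exists x, forall j, log_curvature x j = Lhat (i j) 0.
Proof.
apply: (perron_solution log_curvature_offdiag _ log_curvature_lipschitz).
- by rewrite ltr_wpDl// mulr_ge0.
- exact: log_curvature_coercive.
- exact: log_curvature_subsolution.
Qed.

Lemma log_curvature_inj x y : (forall j, log_curvature x j = log_curvature y j) -> x = y.
Proof.
move=> xy; apply/funext => j; apply/eqP; rewrite eq_le.
by rewrite !(comparison log_curvature_offdiag log_curvature_shift)// => l; rewrite xy.
Qed.

(** A metric realizing the prescribed curvatures vanishes exactly off the prescribed
    faces, since a face has zero total curvature if and only if it has zero
    geodesic curvature. *)
Lemma realizes_exp_metric x : (0 < m < n)%N ->
  (forall j, log_curvature x j = Lhat (i j) 0) ->
  realizes_curvature Phi i Lhat (exp_metric x) /\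
  forall k, realizes_curvature Phi i Lhat k -> k = exp_metric x.
Proof.
move=> /andP[_ mn] xL; have [Lpos _ _] := hL; split.
  have [f fo] : exists f, f \notin faces_in i.
    have : (#|faces_in i| < #|[set: 'I_n]%SET|)%N.
      by rewrite cardsT card_ord (leq_ltn_trans (leq_imset_card _ _))// card_ord.
    rewrite ltnNge => /negP h; apply: contrapT => /forallNP all_in; apply: h.
    by apply: subset_leq_card; apply/fintype.subsetP => f _; apply/negPn/negP.
  split=> //; first by split; [exact: exp_metric_ge0|exists f; exact: extend0_out].
  by move=> g go; apply: total_curvature_eq0; exact: extend0_out.
move=> k [[k0 _] kin kout].
have kpos j : 0 < k (i j) 0.
  rewrite lt_neqAle k0 andbT; apply/eqP => kj; have := Lpos j.
  by rewrite -kin total_curvature_eq0 ?ltxx.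
have kzero f : f \notin faces_in i -> k f 0 = 0.
  move=> fo; apply/eqP; rewrite eq_le k0 andbT leNgt; apply/negP => kf.
  by have := total_curvature_gt0 hPhi k0 kf; rewrite kout// ltxx.
have kE : k = exp_metric (fun j => ln (k (i j) 0)).
  apply/matrixP => f z; rewrite ord1.
  have [/faces_inP[j ->]|fo] := boolP (f \in faces_in i).
    by rewrite exp_metric_in lnK ?posrE.
  by rewrite kzero// /exp_metric extend0_out.
rewrite kE; congr exp_metric; apply: log_curvature_inj => j.
by rewrite xL -kin /log_curvature -kE.
Qed.

End LogCoordinates.

(** * The prescribed combinatorial Ricci flow *)

Unset Implicit Arguments.
Set Strict Implicit.
Set Printing Implicit Defensive.

Theorem theorem1p11 (R : realType) (S : topologicalType)
    (hS : closed_surface R S) (D : cell_decomposition R S)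
    (Phi : edge D -> R) (hPhi : forall e, 0 < Phi e < pi / 2)
    (m : nat) (hm : (1 <= m <= nfaces D - 1)%N)
    (i : 'I_m -> 'I_(nfaces D)) (hi : forall a b : 'I_m, (a < b)%N -> (i a < i b)%N)
    (Lhat : 'cV[R]_(nfaces D)) (hL : curvature_set Phi i Lhat)
    (k0 : 'cV[R]_m) (hk0 : forall j, 0 < k0 j 0) :
  exists K : R -> 'cV[R]_m,
    global_flow_solution Phi i Lhat k0 K /\
    (exists khat : 'cV[R]_(nfaces D),
       [/\ realizes_curvature Phi i Lhat khat,
           forall k, realizes_curvature Phi i Lhat k -> k = khat &
           extend0 i (K t) @[t --> +oo] --> khat]) /\
    (forall khat : 'cV[R]_(nfaces D),
       extend0 i (K t) @[t --> +oo] --> khat -> coordinate_face i khat).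
Proof.
have i_inj : injective i.
  move=> a b ab; apply: val_inj.
  by case: (ltngtP a b) => // /hi; rewrite ab ltnn.
have mn : (0 < m < nfaces D)%N.
  by case/andP: hm => m0 mn; rewrite m0 (leq_ltn_trans mn)// subn1 ltn_predL (leq_ltn_trans _ (ltn_ord (i (Ordinal m0)))).
pose G := log_curvature Phi i; pose b j := Lhat (i j) 0.
pose F x j := - (G x j - b j).
pose C : R := 16 * #|edge D|%:R + 1.
have C0 : 0 < C by rewrite ltr_wpDl// mulr_ge0.
have Fl : sup_lipschitz C F.
  move=> x y d j xy; rewrite /F.
  have : G y j - G x j <= C * d.
    by apply: log_curvature_lipschitz => // l; rewrite distrC.
  lra.
have [x [x0 dx]] := global_solution (fun j => ln (k0 j 0)) C0 Fl.
have [xh xhL] := log_curvature_equilibrium hPhi i_inj hL.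
have [xhr xhu] := realizes_exp_metric hPhi i_inj hL mn xhL.
have xcvg := flow_converges (log_curvature_offdiag hPhi i_inj)
  (log_curvature_shift hPhi i_inj) xhL dx.
pose K t : 'cV[R]_m := \col_j expR (x t j).
have xc j (t : R) : 0 <= t -> {for t, continuous (x^~ j)}.
  by move=> t0; apply: is_derive_continuous; exact: dx.
have Kcvg : extend0 i (K t) @[t --> +oo] --> exp_metric i xh.
  apply: cvg_mx => f z; rewrite ord1.
  have [/faces_inP[j ->]|fo] := boolP (f \in faces_in i).
    rewrite exp_metric_in//; under eq_cvg do rewrite exp_metric_in//.
    by apply: continuous_cvg; [exact: continuous_expR|exact: xcvg].
  rewrite /exp_metric extend0_out//; under eq_cvg do rewrite extend0_out//.
  exact: cvg_cst.
exists K; split; [split|split].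
- split.
  + by apply/matrixP => j z; rewrite ord1 mxE x0 lnK ?posrE.
  + apply: cvg_mx => j z; rewrite ord1; under eq_cvg do rewrite mxE.
    rewrite -[k0 j 0]lnK ?posrE// -x0.
    apply: continuous_cvg; first exact: continuous_expR.
    exact/cvg_at_right_filter/xc.
  + by move=> t _ _ j; rewrite mxE expR_gt0.
  + move=> t t0 _ j; have -> : (fun s => K s j 0) = expR \o x^~ j.
      by apply/funext => s; rewrite mxE.
    rewrite mxE mulrC; apply: is_derive1_comp; exact/dx/ltW.
- move=> T K' T0 [K'0 K'c K'pos dK'] t t0 tT.
  move: t0; rewrite le_eqVlt => /predU1P[<-|t0].
    by rewrite K'0; apply/matrixP => j z; rewrite ord1 mxE x0 lnK ?posrE.
  pose y s j := ln (K' s j 0).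
  have lt_T (s : R) : s <= t -> (s%:E < T)%E.
    by move=> st; apply: le_lt_trans tT; rewrite lee_fin.
  have yE s : 0 <= s <= t -> \col_j expR (y s j) = K' s.
    move=> /andP[s0 st]; apply/matrixP => j z; rewrite ord1 mxE lnK// posrE.
    by apply: K'pos => //; exact: lt_T.
  suff yx j : y t j = x t j.
    by rewrite -[LHS]yE ?lexx ?(ltW t0)//; apply/matrixP => j z; rewrite !mxE yx.
  apply/esym; apply: (solution_unique C0 Fl t0 x0) => //.
  + by move=> {}j; rewrite /y K'0.
  + by move=> {}j; rewrite -x0; exact/cvg_at_right_filter/xc.
  + move=> {}j; apply: continuous_cvg; first exact: continuous_ln (hk0 j).
    exact: (cvg_comp _ _ K'c (@coord_continuous R m 1 j 0 k0)).
  + by move=> {}j s /andP[s0 _]; exact/dx/ltW.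
  + move=> {}j s /andP[s0 st].
    have Kp : 0 < K' s j 0 by apply: K'pos; [exact: ltW|exact: lt_T].
    have dK := dK' s s0 (lt_T s st) j.
    have dl := is_derive1_ln Kp.
    have := is_derive1_comp dl dK.
    rewrite mulrC mulfK ?gt_eqF// /F /G /log_curvature /exp_metric.
    by rewrite yE// (ltW s0).
- by exists (exp_metric i xh).
- move=> khat Kk; have -> : khat = exp_metric i xh by exact: cvg_unique Kk Kcvg.
  split=> f; last exact: extend0_out.
  by move=> /faces_inP[j ->]; rewrite exp_metric_in// expR_gt0.
Qed.
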